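(* Let $\Gamma_n$ be a sample covariance matrix with empirical eigenvalue distribution $\mu_{\Gamma_n}$, and let the $G^2$-estimator be $$G^2_n(z)=\frac{\hat\theta(z)}{z}\,m_{\mu_{\Gamma_n}}(\hat\theta(z)),$$ where the function $\hat\theta(z)$ is the solution to the equation $$\hat\theta(z)\,c\,m_{\mu_{\Gamma_n}}(\hat\theta(z))-(1-c)+\frac{\hat\theta(z)}{z}=0.$$ Then the following holds for real $z<0$: $$G^2_n(z)=m_{\mu_{\Gamma_n}\oslash\mu_c}(z).$$
   Context: $\Gamma_n$ is the $n\times n$ sample covariance matrix formed from $N$ independent, identically distributed random vector observations of length $n$, and $c=\lim_{n\to\infty} n/N$. The Stieltjes transform of a probability measure $\mu$ is $m_\mu(z)=\int\frac{1}{\lambda-z}\,d\mu(\lambda)$; for measures supported on $[0,\infty)$ it is also considered at real $z<0$. $\mu_c$ is the Marchenko–Pastur law with parameter $c$, i.e. the measure whose $k$-th free cumulant is $c^{k-1}$ for all $k\ge1$ (it is the almost sure limit of the empirical eigenvalue distribution of $\frac1N W_nW_n^*$ for $n\times N$ matrices $W_n$ with i.i.d. entries of mean zero and unit variance, $n/N\to c$). The symbol $\boxtimes$ denotes multiplicative free convolution: $\mu_1\boxtimes\mu_2$ is the distribution of the product of free random variables with distributions $\mu_1$ and $\mu_2$. The symbol $\oslash$ denotes multiplicative free deconvolution: $\mu\oslash\nu$ is the (unique) $\mu_1$ with $\mu=\mu_1\boxtimes\nu$, which can be viewed as an operation on moments. *)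

(* Defs.v *)
From HB Require Import structures.
From mathcomp Require Import all_boot all_order all_algebra.
From mathcomp Require Import all_classical all_reals all_analysis.
From mathcomp Require Import complex spectral.
Set Implicit Arguments.
Unset Strict Implicit.
Unset Printing Implicit Defensive.
Import Order.TTheory GRing.Theory Num.Theory.
Import numFieldNormedType.Exports.
Local Open Scope classical_set_scope.
Local Open Scope complex_scope.
Local Open Scope ring_scope.
Local Open Scope sesquilinear_scope.

(* The Borel sigma-algebra of C^n, generated by the real and imaginary parts
   of the coordinates. *)
Definition borel_cV (R : realType) (n : nat) : set (set 'cV[R[i]]_n) :=
  <<s [set X : set 'cV[R[i]]_n | exists (j : 'I_n) (B : set R), measurable B /\
        (X = [set v | B (complex.Re (v j 0))] \/
         X = [set v | B (complex.Im (v j 0))])] >>.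

Definition random_vector (d : measure_display) (T : measurableType d)
    (R : realType) (n : nat) (y : T -> 'cV[R[i]]_n) : Prop :=
  forall B, borel_cV B -> measurable (y @^-1` B).

(* Taking B i = setT for i outside a subfamily shows that the product rule over
   the whole family is mutual independence. *)
Definition iid_random_vectors (d : measure_display) (T : measurableType d)
    (R : realType) (P : probability T R) (n N : nat)
    (y : 'I_N -> T -> 'cV[R[i]]_n) : Prop :=
  [/\ forall i, random_vector (y i),
      forall i j B, borel_cV B -> P (y i @^-1` B) = P (y j @^-1` B)
    & forall B : 'I_N -> set 'cV[R[i]]_n, (forall i, borel_cV (B i)) ->
        fine (P (\bigcap_(i in [set: 'I_N]) (y i @^-1` B i))) =
        \prod_(i < N) fine (P (y i @^-1` B i))].

Definition sample_covariance (R : realType) (n N : nat)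
    (y : 'I_N -> 'cV[R[i]]_n) : 'M[R[i]]_n :=
  N%:R^-1 *: \sum_(i < N) y i *m (y i)^t*.

(* n^-1 \sum_k dirac (lambda_k), for A Hermitian with eigenvalues lambda_k
   listed with multiplicity. *)
Definition empirical_eigenvalue_distribution (R : realType) (n : nat)
    (A : 'M[R[i]]_n) : {measure set R -> \bar R} :=
  mscale (n%:R^-1)%:nng (msum (fun k =>
    \d_ (nth 0 [seq complex.Re (spectral_diag A 0 j) | j <- enum 'I_n] k)) n).

Definition moment (R : realType) (mu : {measure set R -> \bar R}) (k : nat) : R :=
  Rintegral mu setT (fun x => x ^+ k).

Definition stieltjes (R : realType) (mu : {measure set R -> \bar R}) (z : R) : R :=
  Rintegral mu setT (fun x => (x - z)^-1).

Definition real_analytic_at (R : realType) (f : R -> R) (x : R) : Prop :=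
  exists (a : nat -> R) (r : R), 0 < r /\
    forall y, `|y - x| < r -> series (fun k => a k * (y - x) ^+ k) @ \oo --> f y.

(* A multiplicative free deconvolution is in general only a moment sequence m:
   for instance, when c > 0, dirac 1 is not the free convolution of a probability
   measure with the Marchenko-Pastur law.  Its Stieltjes transform is the one given by the
   moments, m(z) = - \sum_k m_k / z^(k+1) near -oo (the termwise integral of
   1 / (x - z) = - \sum_k x^k / z^(k+1)), continued analytically along the real
   axis from -oo up to z.  The value v is unique when it exists. *)
Definition is_moment_stieltjes (R : realType) (m : nat -> R) (z v : R) : Prop :=
  exists f : R -> R,
    [/\ forall w, w <= z -> real_analytic_at f w,
        exists r, forall w, w < r ->
          series (fun k => - (m k / w ^+ k.+1)) @ \oo --> f w
      & f z = v].

Definition moment_stieltjes (R : realType) (m : nat -> R) (z : R) : R :=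
  xget 0 [set v | is_moment_stieltjes m z v].

(* (A, phi) is a noncommutative probability space when phi 1 = 1.  The x i are
   free when phi vanishes on alternating products of centred elements of the
   unital subalgebras C[x i]; horner_alg a p is the value of p at a. *)
Definition free_family (C : comNzRingType) (A : algType C) (phi : {scalar A})
    (I : eqType) (x : I -> A) : Prop :=
  forall s : seq (I * {poly C}), s != [::] ->
    sorted [rel u v | u.1 != v.1] s ->
    (forall u, u \in s -> phi (horner_alg (x u.1) u.2) = 0) ->
    phi (\prod_(u <- s) horner_alg (x u.1) u.2) = 0.

Definition has_moments (R : realType) (A : algType R[i]) (phi : {scalar A})
    (a : A) (m : nat -> R) : Prop :=
  forall k, phi (a ^+ k) = (m k)%:C.

(* On moments: freeness determines m from m1 and m2, whichever (A, phi), a and b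
   realise them. *)
Definition free_mulconv (R : realType) (m1 m2 m : nat -> R) : Prop :=
  exists (A : algType R[i]) (phi : {scalar A}) (a b : A),
    [/\ phi 1 = 1,
        free_family phi (fun i : bool => if i then a else b),
        has_moments phi a m1,
        has_moments phi b m2
      & has_moments phi (a * b) m].

Definition free_muldeconv (R : realType) (m m2 m1 : nat -> R) : Prop :=
  free_mulconv m1 m2 m.

(* The free cumulants are the coefficients of the R-transform
   R(z) = \sum_(k >= 1) kappa_k z^(k-1).  With M(z) = \sum_n m_n z^n its defining
   relation reads M(z) = 1 + \sum_(s >= 1) kappa_s (z M(z))^s; the equation below
   is its coefficient of z^n, for which M may be truncated to degree n. *)
Definition free_cumulants (R : realType) (m kappa : nat -> R) : Prop :=
  m 0%N = 1 /\
  forall n, (0 < n)%N ->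
    m n = \sum_(1 <= s < n.+1)
            kappa s * ((\poly_(i < n.+1) m i) ^+ s)`_(n - s).

Definition marchenko_pastur (R : realType) (c : R)
    (mu : probability R R) : Prop :=
  (forall k, mu.-integrable setT (fun x : R => (x ^+ k)%:E)) /\
  free_cumulants (moment mu) (fun k => c ^+ k.-1).

Definition G2_equation (R : realType) (c : R) (mu : {measure set R -> \bar R})
    (z t : R) : Prop :=
  t * c * stieltjes mu t - (1 - c) + t / z = 0.

(* "The solution" is the only one on the half-line t < 0, where the transform of
   a measure on [0, +oo[ is considered.  For c < 1 it exists for every z < 0;
   for larger c it may exist only for z below some b < 0. *)
Definition G2_theta (R : realType) (c : R) (mu : {measure set R -> \bar R})
    (b : R) (theta : R -> R) : Prop :=
  forall z, z < b ->
    [/\ theta z < 0, G2_equation c mu z (theta z)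
      & forall t, t < 0 -> G2_equation c mu z t -> t = theta z].

Definition G2 (R : realType) (mu : {measure set R -> \bar R})
    (theta : R -> R) (z : R) : R :=
  theta z / z * stieltjes mu (theta z).

(* Main.v *)
(** With psi_m(x) = sum_(k >= 1) m_k x^k, the S-transform of the Marchenko-Pastur
law is 1 / (1 + c z), so that mu = nu [x] mu_c amounts to the formal identity
psi_mu(X(u)) = psi_nu(u) with X(u) = u / (1 + c psi_nu(u)).  With x = 1 / theta(z)
and u = 1 / z, the equation of theta reads U(x) := x (1 + c psi_mu(x)) = u, of which
x = X(u) is the solution near u = 0; hence
G2(z) = - (1 + psi_mu(x)) / z = - (1 + psi_nu(1 / z)) / z near -oo.  As U is convex on
x < 0, having solutions for all z < b forces U' <> 0 at 1 / theta(z), so that G2 is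
analytic there and is the analytic continuation of the Stieltjes transform of nu. *)

Require Import Defs.
From HB Require Import structures.
From mathcomp Require Import all_boot all_order all_algebra.
From mathcomp Require Import all_classical all_reals all_analysis.
From mathcomp Require Import measurable_realfun complex spectral.
From mathcomp Require Import ring lra zify.
Set Implicit Arguments.
Unset Strict Implicit.
Unset Printing Implicit Defensive.
Import Order.TTheory GRing.Theory Num.Theory.
Import numFieldNormedType.Exports.
Local Open Scope classical_set_scope.
Local Open Scope ring_scope.

(** * Formal power series *)

(** The obstacle is that neither growth of [nu] nor regularity of [theta] is given; both are
    extracted from the equation U(x) = 1 / w by solving it in power series. Adjoining the unknowns
    Q_j = 1 / (1 - lam_j x) makes the equation quadratic, the condition U' <> 0 lets the linear
    terms be solved for, and a scalar quadratic majorant bounds the coefficients. A convergent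
    solution gives a negative root, and the uniqueness contained in [G2_theta] identifies it with 1
    / theta(w), which settles the choice of branch. The same system with base point x = 0 makes the
    series of [nu] converge. On the free side [phi] carries neither positivity nor topology, so the
    argument takes place in power series with coefficients in the algebra: resolvents are formal
    geometric series, scalar series are central, and freeness is applied to each coefficient. *)

Definition fps (A : Type) : Type := nat -> A.

HB.instance Definition _ (A : zmodType) := GRing.Zmodule.copy (fps A) (nat -> A).

Section FpsRing.
Variable A : nzRingType.
Implicit Types f g h : fps A.

Definition fps_one : fps A := fun n => (n == 0%N)%:R.
Definition fps_mul f g : fps A := fun n => \sum_(j < n.+1) f j * g (n - j)%N.

Let tr n f : {poly A} := \poly_(i < n.+1) f i.

(** Coefficients up to n of a product see only the truncations to degree n, so the ring laws can be
    inherited from polynomials. *)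
Let fps_mul_tr f g n k : (k <= n)%N -> fps_mul f g k = (tr n f * tr n g)`_k.
Proof.
move=> kn; rewrite coefM; apply: eq_bigr => j _; rewrite !coef_poly !ltnS.
by have := ltn_ord j; rewrite ltnS => jk; rewrite !ifT //; lia.
Qed.

Let fps_mulA : associative fps_mul.
Proof.
move=> f g h; apply/funext => n.
transitivity ((tr n f * (tr n g * tr n h))`_n).
  rewrite coefM; apply: eq_bigr => j _; rewrite coef_poly ltn_ord.
  by rewrite -fps_mul_tr // leq_subr.
rewrite mulrA coefM; apply: eq_bigr => j _; rewrite coef_poly ltnS leq_subr.
by rewrite -fps_mul_tr // -(ltnS j).
Qed.

Let fps_mul1l : left_id fps_one fps_mul.
Proof.
move=> f; apply/funext => n; rewrite /fps_mul big_ord_recl /= mul1r subn0.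
by rewrite big1 ?addr0 // => i _; rewrite /fps_one mul0r.
Qed.

Let fps_mul1r : right_id fps_one fps_mul.
Proof.
move=> f; apply/funext => n; rewrite /fps_mul big_ord_recr /= subnn mulr1.
rewrite big1 ?add0r // => i _; rewrite /fps_one subn_eq0 leqNgt ltn_ord.
by rewrite mulr0.
Qed.

Let fps_mulDl : left_distributive fps_mul +%R.
Proof.
move=> f g h; apply/funext => n; rewrite /fps_mul -[RHS]big_split /=.
by apply: eq_bigr => j _; rewrite -mulrDl.
Qed.

Let fps_mulDr : right_distributive fps_mul +%R.
Proof.
move=> f g h; apply/funext => n; rewrite /fps_mul -[RHS]big_split /=.
by apply: eq_bigr => j _; rewrite -mulrDr.
Qed.

Let fps_one_neq0 : fps_one != 0.
Proof.
by apply/eqP => /(congr1 (fun f : fps A => f 0%N)) /eqP; rewrite oner_eq0.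
Qed.

HB.instance Definition _ := GRing.Zmodule_isNzRing.Build (fps A)
  fps_mulA fps_mul1l fps_mul1r fps_mulDl fps_mulDr fps_one_neq0.

Lemma fps0E n : (0 : fps A) n = 0. Proof. by []. Qed.
Lemma fps1E n : (1 : fps A) n = (n == 0%N)%:R. Proof. by []. Qed.
Lemma fpsDE f g n : (f + g) n = f n + g n. Proof. by []. Qed.
Lemma fpsNE f n : (- f) n = - f n. Proof. by []. Qed.
Lemma fpsBE f g n : (f - g) n = f n - g n. Proof. by []. Qed.
Lemma fpsME f g n : (f * g) n = \sum_(j < n.+1) f j * g (n - j)%N.
Proof. by []. Qed.

Lemma fps_sumE (I : Type) (r : seq I) (P : pred I) (F : I -> fps A) n :
  (\sum_(i <- r | P i) F i) n = \sum_(i <- r | P i) F i n.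
Proof. by elim/big_rec2 : _ => // i x y _ <-. Qed.

Lemma fpsM0 f g : (f * g) 0%N = f 0%N * g 0%N.
Proof. by rewrite fpsME big_ord1. Qed.

Lemma fps_eqM f f' g g' n : (forall j, (j <= n)%N -> f j = f' j) ->
  (forall j, (j <= n)%N -> g j = g' j) -> (f * g) n = (f' * g') n.
Proof.
move=> ff gg; rewrite !fpsME; apply: eq_bigr => j _.
by rewrite ff ?gg ?leq_subr // -(ltnS j).
Qed.

Lemma fpsM_order f g m n : (forall j, (j < m)%N -> f j = 0) ->
  (forall j, (j < n)%N -> g j = 0) -> forall j, (j < m + n)%N -> (f * g) j = 0.
Proof.
move=> f0 g0 k kmn; rewrite fpsME big1 // => j _.
have [/f0->|mj] := ltnP j m; first by rewrite mul0r.
by rewrite g0 ?mulr0 //; have := ltn_ord j; lia.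
Qed.

Lemma fpsX_order f n : f 0%N = 0 -> forall j, (j < n)%N -> (f ^+ n) j = 0.
Proof.
move=> f0; elim: n => // n IH j jn; rewrite exprS.
by apply: (@fpsM_order _ _ 1 n) => // -[|//] _.
Qed.

Definition fpsC (a : A) : fps A := fun n => if n is 0%N then a else 0.
Definition fpsX : fps A := fun n => (n == 1%N)%:R.

Lemma fpsCM a f n : (fpsC a * f) n = a * f n.
Proof.
rewrite fpsME big_ord_recl /= subn0 big1 ?addr0 // => i _.
by rewrite mul0r.
Qed.

Lemma fpsMC a f n : (f * fpsC a) n = f n * a.
Proof.
rewrite fpsME big_ord_recr /= subnn big1 ?add0r // => i _.
by rewrite -(subnSK (ltn_ord i)) mulr0.
Qed.

Lemma fpsXM f n : (fpsX * f) n = if n is m.+1 then f m else 0.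
Proof.
case: n => [|n]; first by rewrite fpsM0 mul0r.
rewrite fpsME 2!big_ord_recl /= mul0r mul1r add0r subn1 big1 ?addr0 // => i _.
by rewrite mul0r.
Qed.

Lemma fpsC_is_zmod : zmod_morphism fpsC.
Proof. by move=> a b; apply/funext => -[|n] //; rewrite fpsBE subr0. Qed.

Lemma fpsC_is_monoid : monoid_morphism fpsC.
Proof.
split=> [|a b]; first by apply/funext => -[].
by apply/funext => n; rewrite fpsCM; case: n => //= n; rewrite mulr0.
Qed.

HB.instance Definition _ := GRing.isZmodMorphism.Build _ _ fpsC fpsC_is_zmod.
HB.instance Definition _ := GRing.isMonoidMorphism.Build _ _ fpsC fpsC_is_monoid.

(** The k-th member has order at least k, so the family is locally finite. Finite sums of sufficient
    length thus replace infinite ones. *)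
Lemma fps_sum_trunc (F : nat -> fps A) m n :
  (forall k j, (j < k)%N -> F k j = 0) -> (n < m)%N ->
  (\sum_(k < m) F k) n = (\sum_(k < n.+1) F k) n.
Proof.
move=> F0 nm; rewrite !fps_sumE -(subnKC nm) big_split_ord /=.
rewrite [X in _ + X]big1 ?addr0 // => i _.
by apply: F0 => //=; rewrite ltnS leq_addr.
Qed.

(* The geometric series, an inverse of [1 - f] when f(0) = 0. *)
Definition star f : fps A := fun n => (\sum_(k < n.+1) f ^+ k) n.

Lemma star_trunc f m n : f 0%N = 0 -> (n < m)%N ->
  star f n = (\sum_(k < m) f ^+ k) n.
Proof. by move=> f0 nm; rewrite (fps_sum_trunc _ nm) // => k; exact: fpsX_order. Qed.

Lemma star0 f : star f 0%N = 1.
Proof. by rewrite /star big_ord1. Qed.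

Lemma starMl f : f 0%N = 0 -> (1 - f) * star f = 1.
Proof.
move=> f0; apply/funext => n.
rewrite (@fps_eqM _ (1 - f) _ (\sum_(k < n.+1) f ^+ k)) //; last first.
  by move=> j jn; apply: star_trunc.
rewrite -[1 - f]opprB mulNr -subrX1 opprB fpsBE fpsX_order //.
by rewrite subr0.
Qed.

Lemma starMr f : f 0%N = 0 -> star f * (1 - f) = 1.
Proof.
move=> f0; apply/funext => n.
rewrite (@fps_eqM _ (\sum_(k < n.+1) f ^+ k) _ (1 - f)) //; last first.
  by move=> j jn; apply: star_trunc.
have fC : GRing.comm (1 - f) (\sum_(k < n.+1) f ^+ k).
  apply: commr_sum => i _; apply: commrX; apply: commr_sym.
  by apply: commrB; [exact: commr1|].
rewrite -fC -[1 - f]opprB mulNr -subrX1 opprB fpsBE fpsX_order //.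
by rewrite subr0.
Qed.

End FpsRing.
Arguments fpsX {A}.

Section FpsComRing.
Variable A : comNzRingType.

Let fps_mulC : commutative (@GRing.mul (fps A)).
Proof.
move=> f g; apply/funext => n; rewrite !fpsME [RHS](reindex_inj rev_ord_inj) /=.
by apply: eq_bigr => j _; rewrite mulrC subSS subKn // -(ltnS j).
Qed.

HB.instance Definition _ := GRing.PzRing_hasCommutativeMul.Build (fps A) fps_mulC.
End FpsComRing.

Section FpsMap.
Variables (A B : nzRingType) (h : {rmorphism A -> B}).

Definition fps_map (f : fps A) : fps B := fun n => h (f n).

Let fps_map_is_zmod : zmod_morphism fps_map.
Proof. by move=> f g; apply/funext => n; rewrite /fps_map !fpsBE rmorphB. Qed.

Let fps_map_is_monoid : monoid_morphism fps_map.
Proof.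
split=> [|f g]; apply/funext => n; first by rewrite /fps_map !fps1E rmorph_nat.
rewrite /fps_map !fpsME rmorph_sum.
by apply: eq_bigr => i _; rewrite rmorphM.
Qed.

HB.instance Definition _ := GRing.isZmodMorphism.Build _ _ fps_map fps_map_is_zmod.
HB.instance Definition _ := GRing.isMonoidMorphism.Build _ _ fps_map fps_map_is_monoid.

Lemma fps_mapC a : fps_map (fpsC a) = fpsC (h a).
Proof. by apply/funext => -[|n]; rewrite /fps_map //= rmorph0. Qed.

Lemma fps_mapX : fps_map fpsX = fpsX.
Proof. by apply/funext => n; rewrite /fps_map /fpsX rmorph_nat. Qed.
End FpsMap.

Section FpsComp.
Variable A : comNzRingType.
Implicit Types (f g v : fps A) (q : {poly A}).

(** When v has no constant term, the powers of v above n do not reach degree n, and this is the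
    substitution f(v). *)
Definition fps_comp f v : fps A :=
  fun n => (\sum_(k < n.+1) fpsC (f k) * v ^+ k) n.

Lemma fps_compE f v n : fps_comp f v n = \sum_(k < n.+1) f k * (v ^+ k) n.
Proof. by rewrite /fps_comp fps_sumE; apply: eq_bigr => k _; rewrite fpsCM. Qed.

Lemma fps_comp_poly q v : v 0%N = 0 ->
  (map_poly (@fpsC A) q).[v] = fps_comp (fun k => q`_k) v.
Proof.
move=> v0; apply/funext => n.
rewrite (@horner_coef_wide _ (maxn n.+1 (size (map_poly (@fpsC A) q)))) ?leq_maxr //.
under eq_bigr do rewrite coef_map.
rewrite (fps_sum_trunc (F := fun k => fpsC q`_k * v ^+ k)) ?leq_maxl //.
by move=> k j jk; rewrite fpsCM fpsX_order // mulr0.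
Qed.

(** After truncation of f and g, substitution is evaluation of polynomials, where multiplicativity
    is [hornerM]. *)
Lemma fps_compM f g v : v 0%N = 0 -> fps_comp (f * g) v = fps_comp f v * fps_comp g v.
Proof.
move=> v0; apply/funext => n.
pose tr (f : fps A) := \poly_(i < n.+1) f i.
have trE (h : fps A) j : (j <= n)%N -> fps_comp h v j = (map_poly (@fpsC A) (tr h)).[v] j.
  move=> jn; rewrite fps_comp_poly // !fps_compE; apply: eq_bigr => k _.
  by rewrite coef_poly ifT //; have := ltn_ord k; lia.
rewrite trE // (@fps_eqM _ _ (map_poly (@fpsC A) (tr f)).[v] _ (map_poly (@fpsC A) (tr
  g)).[v]).
- rewrite -hornerM -rmorphM /= !fps_comp_poly // !fps_compE.
  apply: eq_bigr => k _; rewrite coef_poly ltn_ord; congr (_ * _).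
  rewrite coefM fpsME; apply: eq_bigr => j _; have := ltn_ord j; have := ltn_ord k => kn jk.
  by rewrite !coef_poly !ifT //; lia.
- by move=> j jn; apply: trE.
- by move=> j jn; apply: trE.
Qed.

Lemma fps_compD f g v : fps_comp (f + g) v = fps_comp f v + fps_comp g v.
Proof.
apply/funext => n; rewrite fpsDE !fps_compE -big_split /=.
by apply: eq_bigr => k _; rewrite fpsDE mulrDl.
Qed.

Lemma fps_compN f v : fps_comp (- f) v = - fps_comp f v.
Proof.
apply/funext => n; rewrite fpsNE !fps_compE -sumrN.
by apply: eq_bigr => k _; rewrite fpsNE mulNr.
Qed.

Lemma fps_compC a v : fps_comp (fpsC a) v = fpsC a.
Proof.
apply/funext => n; rewrite fps_compE big_ord_recl /= big1 ?addr0; last first.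
  by move=> i _; rewrite mul0r.
by rewrite expr0 fps1E; case: n => [|n]; rewrite ?mulr1 ?mulr0.
Qed.

Lemma fps_comp1 v : fps_comp 1 v = 1.
Proof. by rewrite -(rmorph1 (@fpsC A)) fps_compC. Qed.

Lemma fps_compX v : v 0%N = 0 -> fps_comp fpsX v = v.
Proof.
move=> v0; apply/funext => -[|n]; rewrite fps_compE.
  by rewrite big_ord1 mul0r v0.
rewrite 2!big_ord_recl /= mul0r add0r mul1r expr1 big1 ?addr0 // => i _.
by rewrite mul0r.
Qed.

Lemma fps_comp_id f : fps_comp f fpsX = f.
Proof.
have XE k n : ((fpsX : fps A) ^+ k) n = (n == k)%:R.
  elim: k n => [|k IH] n; first by rewrite expr0 fps1E.
  by rewrite exprS fpsXM; case: n => // n; rewrite IH.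
apply/funext => n; rewrite fps_compE big_ord_recr /= XE eqxx mulr1 big1 ?add0r //.
by move=> i _; rewrite XE gtn_eqF // mulr0.
Qed.

End FpsComp.

Lemma fps_map_comp (A B : comNzRingType) (h : {rmorphism A -> B}) (f v : fps A) :
  fps_map h (fps_comp f v) = fps_comp (fps_map h f) (fps_map h v).
Proof.
apply/funext => n; rewrite /fps_map !fps_compE rmorph_sum.
by apply: eq_bigr => k _; rewrite rmorphM -/(fps_map h v) -rmorphXn.
Qed.

(** * Freeness *)

Section Freeness.
Variables (C : comNzRingType) (A : algType C) (phi : {scalar A}).
Implicit Types (s t : fps C) (F G : fps A) (x y : A).

Definition fps_scal s : fps A := fps_map (in_alg A) s.
Definition fps_phi F : fps C := fun n => phi (F n).

Local Notation "s %:S" := (fps_scal s) (at level 1, format "s %:S").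
Local Notation Phi := fps_phi.

Lemma fps_scalC s F : s%:S * F = F * s%:S.
Proof.
apply/funext => n; rewrite !fpsME [RHS](reindex_inj rev_ord_inj) /=.
apply: eq_bigr => j _; have := ltn_ord j; rewrite ltnS => jn.
rewrite /fps_scal /fps_map subSS subKn //=.
by rewrite mulr_algl mulr_algr.
Qed.

Lemma fps_scalME s F n : (s%:S * F) n = \sum_(j < n.+1) s j *: F (n - j)%N.
Proof. by rewrite fpsME; apply: eq_bigr => j _;
  rewrite /fps_scal /fps_map /= mulr_algl. Qed.

Lemma fps_phiZ s F : Phi (s%:S * F) = s * Phi F.
Proof.
apply/funext => n; rewrite /fps_phi fps_scalME fpsME linear_sum.
by apply: eq_bigr => j _; rewrite linearZ.
Qed.

Lemma fps_phiD F G : Phi (F + G) = Phi F + Phi G.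
Proof. by apply/funext => n; rewrite /fps_phi !fpsDE linearD. Qed.

Lemma fps_phiB F G : Phi (F - G) = Phi F - Phi G.
Proof. by apply/funext => n; rewrite /fps_phi !fpsBE linearB. Qed.

Lemma fps_phi_scal s : phi 1 = 1 -> Phi s%:S = s.
Proof.
by move=> phi1; apply/funext => n; rewrite /fps_phi /fps_scal /fps_map /= linearZ /= phi1
  mulr1.
Qed.

(** Expectation of y / (1 - s x). The case y = 1 gives the moment series at s, and y = x gives the
    series of the shifted moments. *)
Lemma fps_phi_resolvent y x s m : s 0%N = 0 -> (forall k, phi (y * x ^+ k) = m k) ->
  Phi (fpsC y * star (s%:S * fpsC x)) = fps_comp m s.
Proof.
move=> s0 mE; apply/funext => n; rewrite /fps_phi fpsCM /star fps_sumE fps_compE.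
rewrite mulr_sumr linear_sum; apply: eq_bigr => k _.
rewrite exprMn_comm; last exact: fps_scalC.
rewrite /fps_scal -!rmorphXn fpsMC /fps_map /= mulr_algl -scalerAr linearZ /=.
by rewrite mE mulrC.
Qed.

Definition alg_fps x F := forall n, exists q : {poly C}, F n = horner_alg x q.

Lemma alg_fpsC x : alg_fps x (fpsC x).
Proof.
case=> [|n]; first by exists 'X; rewrite horner_algX.
by exists 0; rewrite rmorph0.
Qed.

Lemma alg_fps_scal x s : alg_fps x s%:S.
Proof. by move=> n; exists (s n)%:P; rewrite horner_algC. Qed.

Lemma alg_fpsB x F G : alg_fps x F -> alg_fps x G -> alg_fps x (F - G).
Proof.
by move=> hF hG n; have [p Fp] := hF n; have [q Gq] := hG n;
  exists (p - q); rewrite rmorphB /= -Fp -Gq.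
Qed.

Lemma alg_fps_sum x (I : Type) (r : seq I) (H : I -> A) :
  (forall k, exists q : {poly C}, H k = horner_alg x q) ->
  exists q : {poly C}, \sum_(k <- r) H k = horner_alg x q.
Proof.
move=> hH; elim: r => [|k r [q qE]].
  by exists 0; rewrite big_nil rmorph0.
have [p pE] := hH k.
by exists (p + q); rewrite big_cons rmorphD /= -pE -qE.
Qed.

Lemma alg_fpsM x F G : alg_fps x F -> alg_fps x G -> alg_fps x (F * G).
Proof.
move=> hF hG n; rewrite fpsME; apply: alg_fps_sum => k.
have [p Fp] := hF k; have [q Gq] := hG (n - k)%N.
by exists (p * q); rewrite rmorphM /= -Fp -Gq.
Qed.

Lemma alg_fps_star x F : alg_fps x F -> alg_fps x (star F).
Proof.
move=> hF n; rewrite /star fps_sumE; apply: alg_fps_sum => k.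
suff: alg_fps x (F ^+ k) by apply.
elim: (k : nat) => [|m IH]; last by rewrite exprS; exact: alg_fpsM.
rewrite expr0; have -> : 1 = (1 : fps C)%:S by rewrite /fps_scal rmorph1.
exact: alg_fps_scal.
Qed.

(** A series killed by [fps_phi] has all its coefficients centred, so each coefficient of the
    product is a finite sum of alternating products of centred elements. *)
Lemma alternating_fps (I : eqType) (x : I -> A) (l : seq (I * fps A)) :
  phi 1 = 1 -> free_family phi x -> l != [::] ->
  sorted [rel u v | u.1 != v.1] l ->
  (forall u, u \in l -> alg_fps (x u.1) u.2 /\ Phi u.2 = 0) ->
  Phi (\prod_(u <- l) u.2) = 0.
Proof.
move=> phi1 free_x l0 l_sorted l_centred; apply/funext => n; rewrite /fps_phi fps0E.
(* Induction on [l]: its factors are replaced one by one by polynomials for their coefficients,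
   collected in [s]. Alternation is kept for the concatenation of both index lists. *)
suff gen (s : seq (I * {poly C})) : (s != [::]) || (l != [::]) ->
    sorted (fun u v => u != v) (map fst s ++ map fst l) ->
    (forall u, u \in s -> phi (horner_alg (x u.1) u.2) = 0) ->
    phi (\prod_(u <- s) horner_alg (x u.1) u.2 * (\prod_(u <- l) u.2) n) = 0.
  have := gen [::]; rewrite big_nil mul1r; apply.
  - by rewrite l0 orbT.
  - by rewrite sorted_map.
  - by [].
elim: l {l0 l_sorted} l_centred s n => [|[i F] l IH] l_centred s n.
  rewrite eqxx orbF cats0 => s0 s_sorted s_centred; rewrite big_nil fps1E.
  case: n => [|n]; last by rewrite mulr0 linear0.
  rewrite mulr1; apply: free_x => //.
  by move: s_sorted; rewrite sorted_map.
move=> _ s_sorted s_centred; rewrite big_cons fpsME mulr_sumr linear_sum big1 // => j _.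
have [hF F0] := l_centred (i, F) (mem_head _ _).
have [q qE] := hF j; rewrite /= in qE F0.
have -> : (\prod_(u <- s) horner_alg (x u.1) u.2) * (F j * (\prod_(u <- l) u.2) (n - j)%N) =
    \prod_(u <- rcons s (i, q)) horner_alg (x u.1) u.2 * (\prod_(u <- l) u.2) (n - j)%N.
  by rewrite -cats1 big_cat big_seq1 /= -qE mulrA.
apply: IH.
- by move=> u ul; apply: l_centred; rewrite inE ul orbT.
- by case: (s).
- by rewrite map_rcons -cats1 -catA.
- move=> u; rewrite mem_rcons inE => /predU1P[->|]; last exact: s_centred.
  by rewrite /= -qE; exact: (congr1 (fun f : fps C => f j) F0).
Qed.

Section FreeFps.
Variables (a b : A) (F G : fps A).
Hypotheses (phi1 : phi 1 = 1) (free_ab : free_family phi (fun i : bool =>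
  if i then a else b)).
Hypotheses (aF : alg_fps a F) (F0 : Phi F = 0) (bG : alg_fps b G) (G0 : Phi G = 0).

(** The alternating words F G F ... and G F G ..., to which (F G)^n reduces with an optional G on
    its left and F on its right. *)
Let alt := fix alt n (i : bool) : seq (bool * fps A) :=
  if n is m.+1 then (i, if i then F else G) :: alt m (~~ i) else [::].

Let phi_alt n i : Phi (\prod_(u <- alt n.+1 i) u.2) = 0.
Proof.
apply: (alternating_fps phi1 free_ab) => //.
- have alt_path : forall m j, path [rel u v | u.1 != v.1] (j, if j then F else G) (alt m
  (~~ j)).
    by elim=> //= m IH j; rewrite IH andbT; case: j.
  exact: alt_path.
- by elim: n.+1 i => //= m IH i u; rewrite inE => /predU1P[->|/IH //]; case: i.
Qed.

Let alt_even n : \prod_(u <- alt n.*2 true) u.2 = (F * G) ^+ n.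
Proof. by elim: n => [|n IH]; rewrite ?big_nil // doubleS /= !big_cons IH exprS mulrA. Qed.

Let alt_odd n : \prod_(u <- alt n.*2.+1 true) u.2 = (F * G) ^+ n * F.
Proof.
elim: n => [|n IH]; first by rewrite /= big_seq1 mul1r.
by rewrite doubleS [alt _ _]/= 2!big_cons [alt]lock /= -lock IH exprS !mulrA.
Qed.

(** Expanding the geometric series, every term is a nonempty alternating word, except the term 1 of
    [S] itself. *)
Lemma free_phi_star : F 0%N = 0 ->
  let S := star (F * G) in
  [/\ Phi S = 1, Phi (G * S) = 0, Phi (S * F) = 0 & Phi (G * S * F) = 0].
Proof.
move=> F00 S; have FG0 : (F * G) 0%N = 0 by rewrite fpsM0 F00 mul0r.
have phi_star (l r : fps A) : (forall n, Phi (l * (F * G) ^+ n * r) =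
  0) -> Phi (l * S * r) = 0.
  move=> lr0; apply/funext => n.
  (* At a fixed coefficient the geometric series may be cut to a finite sum, through which linearity
     of [phi] passes. *)
  have -> : Phi (l * S * r) n = Phi (l * (\sum_(k < n.+1) (F * G) ^+ k) * r) n.
    congr (phi _); apply: fps_eqM => // j jn; apply: fps_eqM => // k kj.
    by apply: star_trunc; rewrite // ltnS (leq_trans kj).
  rewrite mulr_sumr mulr_suml /fps_phi fps_sumE linear_sum big1 // => k _.
  exact: (congr1 (fun f : fps C => f n) (lr0 k)).
split.
- have -> : S = 1 + F * G * S * 1.
    rewrite mulr1 -(starMl FG0) mulrBl mul1r subrK //.
  rewrite fps_phiD phi_star ?addr0; last first.
    by move=> n; rewrite mulr1 -exprS -alt_even phi_alt.
  apply/funext => -[|n]; rewrite /fps_phi fps1E ?phi1 ?linear0 //.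
- rewrite -[G * S]mulr1; apply: phi_star => n.
  by rewrite mulr1 -alt_even; have := phi_alt n.*2 false; rewrite /= big_cons.
- rewrite -[S * F]mul1r mulrA; apply: phi_star => n.
  by rewrite mul1r -alt_odd phi_alt.
- apply: phi_star => n; rewrite -mulrA -alt_odd.
  by have := phi_alt n.*2.+1 false; rewrite [alt _ _]/= big_cons.
Qed.

End FreeFps.

End Freeness.

(** * Free convolution with the Marchenko-Pastur law *)

(* As N = (m - 1) / z, the second equation says that the R-transform is 1 / (1 - c z). *)
Definition mp_series (C : comNzRingType) (c : C) (m : fps C) : Prop :=
  exists2 N : fps C, m = 1 + fpsX * N & N * (1 - fpsC c * fpsX * m) = m.

Section MpSubst.
Variables (C : comNzRingType) (c : C).

(** The composite Y of m with v and the series P both solve Y - 1 = v Y (1 + c (Y - 1)). The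
    difference of two solutions is killed by some 1 - y with y(0) = 0, which is invertible. *)
Lemma mp_series_subst (m N v P : fps C) :
  m = 1 + fpsX * N -> N * (1 - fpsC c * fpsX * m) = m -> v 0%N = 0 ->
  v * P * (1 + fpsC c * (P - 1)) = P - 1 ->
  fps_comp m v = P /\ fps_comp N v * (1 - fpsC c * v * P) = P.
Proof.
move=> mE NE v0 vP.
have YE : fps_comp m v = 1 + v * fps_comp N v.
  by rewrite mE fps_compD fps_compM // fps_compX // fps_comp1.
have NvE : fps_comp N v * (1 - fpsC c * v * fps_comp m v) = fps_comp m v.
  rewrite -[in RHS]NE fps_compM // fps_compD fps_comp1 fps_compN !fps_compM //.
  by rewrite fps_compC fps_compX.
suff YP : fps_comp m v = P by split; rewrite // -[RHS]YP -NvE YP.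
set Y := fps_comp m v in YE NvE *; set Nv := fps_comp N v in YE NvE.
pose y := v * (fpsC c * (Y + P - 1) + 1).
have y0 : y 0%N = 0 by rewrite /y fpsM0 v0 mul0r.
have D0 : (Y - P) * (1 - y) = 0.
  have E1 : (Y - 1) * (1 - fpsC c * v * Y) = v * Y.
    have -> : Y - 1 = v * Nv by rewrite YE addrC addKr.
    by rewrite -mulrA NvE.
  have -> : (Y - P) * (1 - y) = ((Y - 1) * (1 - fpsC c * v * Y) - v * Y)
     - (P - 1 - v * P * (1 + fpsC c * (P - 1))) by rewrite /y; ring.
  by rewrite E1 vP !subrr.
apply/eqP; rewrite -subr_eq0; apply/eqP.
by rewrite -[Y - P]mulr1 -(starMl y0) mulrA D0 mul0r.
Qed.
End MpSubst.

(** The cancellation behind the factorisation in [free_mp_comp]: there e = 1 - z a, k is the scalar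
    series [K], and be stands for [W] b, so that the right-hand side becomes K (1 - X a b). *)
Lemma intertwined_expansion (A : nzRingType) (k e be : A) : k * e = e * k ->
  e * (1 - be + k * be) - (k - e) * (be - 1) = k * (1 - (1 - e) * be).
Proof.
move=> ke; rewrite -mulrN opprB mulrDr mulrBl [_ + (k * _ - _)]addrC addrA subrK.
by rewrite [e * _]mulrA -ke -mulrA -mulrDr mulrBl mul1r opprB addrA addrAC.
Qed.

Section FreeMp.
Variables (C : comNzRingType) (A : algType C) (phi : {scalar A}) (a b : A) (c : C).
Variables (ma mb mab : fps C).
Hypotheses (phi1 : phi 1 = 1) (free_ab : free_family phi (fun i : bool =>
  if i then a else b)).
Hypotheses (maE : forall k, phi (a ^+ k) = ma k) (mbE : forall k, phi (b ^+ k) = mb k).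
Hypothesis mabE : forall k, phi ((a * b) ^+ k) = mab k.

Local Notation "s %:S" := (@fps_scal C A s) (at level 1, format "s %:S").

(* Voiculescu's S-transform identity, in a form which does not invert the series
   of a: [1 - X a b] factors through [1 - al * be] with al and be centred. *)
Lemma free_mp_comp (X : fps C) : mp_series c mb ->
  X * (1 + fpsC c * (ma - 1)) = fpsX -> fps_comp mab X = ma.
Proof.
move=> [N mbN NE] XE; pose p := ma - 1.
have p0 : p 0%N = 0 by rewrite /p fpsBE -maE expr0 phi1 fps1E subrr.
have np0 : (- p) 0%N = 0 by rewrite fpsNE p0 oppr0.
have cp0 : (- (fpsC c * p)) 0%N = 0 by rewrite fpsNE fpsM0 p0 mulr0 oppr0.
pose K := star (- p); pose W := star (- (fpsC c * p)).
have PE : 1 + p = ma by rewrite /p addrC subrK.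
have PK : ma * K = 1 by rewrite -PE -[p]opprK; exact: starMl.
have WE : (1 + fpsC c * p) * W = 1 by rewrite -[fpsC c * p]opprK; exact: starMl.
have XW : X = fpsX * W by rewrite -XE -/p -mulrA WE mulr1.
have X0 : X 0%N = 0 by rewrite XW fpsM0 mul0r.
(* The S-transform gives the inverse of psi_b at p as p / (1 + p) * S_b(p); here 1 / (1 + p) is [K]
   and S_b(p) = 1 / (1 + c p) is [W]. So the moment series of b takes the value [ma] at [v]. *)
pose v := p * K * W.
have v0 : v 0%N = 0 by rewrite /v !fpsM0 p0 !mul0r.
have KS F : K%:S * F = F * K%:S by exact: fps_scalC.
have [mbv Nv] : fps_comp mb v = ma /\ fps_comp N v * (1 - fpsC c * v * ma) = ma.
  apply: mp_series_subst mbN NE v0 _; rewrite -/p.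
  have -> : v * ma * (1 + fpsC c * p) = p * (ma * K) * ((1 + fpsC c * p) * W).
    by rewrite /v; ring.
  by rewrite PK WE !mulr1.
have KWN : K * W * fps_comp N v = 1.
  have W1 : 1 - fpsC c * v * ma = W.
    have -> : 1 - fpsC c * v * ma = 1 - fpsC c * p * W * (ma * K) by rewrite /v; ring.
    by rewrite PK mulr1 -[X in X - _ = _]WE; ring.
  by rewrite mulrC mulrCA -[X in _ * (_ * X)]W1 Nv mulrC PK.
pose u : fps C := fpsX.
pose Ua := u%:S * fpsC a; pose Vb := v%:S * fpsC b.
have Ua0 : Ua 0%N = 0 by rewrite /Ua fpsM0 /u /fps_scal fps_mapX mul0r.
have Vb0 : Vb 0%N = 0 by rewrite /Vb fpsM0 /fps_scal /fps_map v0 /= scale0r mul0r.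
pose Au := star Ua; pose Bv := star Vb.
(* The factors [K] and [K * W] are the inverses of the expectations of [Au] and of b [Bv], so that
   [al] and [be] are centred. *)
pose al := K%:S * Au - 1; pose be := (K * W)%:S * fpsC b * Bv - 1.
have al_alg : alg_fps a al.
  apply: alg_fpsB; last by rewrite -[1](rmorph1 (fps_map (in_alg A))); exact: alg_fps_scal.
  apply: alg_fpsM; first exact: alg_fps_scal.
  by apply: alg_fps_star; apply: alg_fpsM; [exact: alg_fps_scal|exact: alg_fpsC].
have be_alg : alg_fps b be.
  apply: alg_fpsB; last by rewrite -[1](rmorph1 (fps_map (in_alg A))); exact: alg_fps_scal.
  apply: alg_fpsM; first by apply: alg_fpsM; [exact: alg_fps_scal|exact: alg_fpsC].
  by apply: alg_fps_star; apply: alg_fpsM; [exact: alg_fps_scal|exact: alg_fpsC].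
have Phi1 : fps_phi phi 1 = 1.
  by rewrite -{1}(rmorph1 (fps_map (in_alg A))) (fps_phi_scal _ phi1).
have al_phi : fps_phi phi al = 0.
  rewrite /al fps_phiB fps_phiZ Phi1 -[Au]mul1r -(rmorph1 (@fpsC A)).
  rewrite (@fps_phi_resolvent _ _ _ _ _ _ ma) //; last by move=> k; rewrite mul1r maE.
  by rewrite fps_comp_id mulrC PK subrr.
have be_phi : fps_phi phi be = 0.
  rewrite /be fps_phiB -mulrA fps_phiZ Phi1.
  rewrite (@fps_phi_resolvent _ _ _ _ _ _ N) ?KWN ?subrr // => k.
  by rewrite -exprS mbE mbN fpsDE fps1E add0r fpsXM.
have al0 : al 0%N = 0.
  rewrite /al /Au fpsBE fpsM0 star0 mulr1 fps1E /fps_scal /fps_map /= /K star0.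
  by rewrite scale1r subrr.
have [G1 bG Ga bGa] := free_phi_star phi1 free_ab al_alg al_phi be_alg be_phi al0.
have albe0 : (al * be) 0%N = 0 by rewrite fpsM0 al0 mul0r.
set G := star (al * be) in G1 bG Ga bGa.
have scalM s t : (s * t)%:S = s%:S * t%:S by exact: rmorphM.
have scalB s t : (s - t)%:S = s%:S - t%:S by exact: rmorphB.
have scal1 : 1%:S = 1 by exact: rmorph1.
pose k := K%:S; pose e := 1 - Ua; pose be' := W%:S * fpsC b.
have VbE : 1 - Vb = 1 - be' + k * be'.
  have vE : v = W - K * W by rewrite /v -[p](addKr 1) PE; ring: PK.
  by rewrite /Vb vE scalB mulrBl scalM -mulrA opprB addrCA addrC.
have e_al : e * al = k - e.
  by rewrite /al mulrBr mulr1 mulrA -KS -mulrA (starMl Ua0) mulr1.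
have be_Vb : be * (1 - Vb) = be' - 1.
  rewrite /be mulrBl mul1r -[_ * Bv * _]mulrA (starMr Vb0 : Bv * _ =
    1) mulr1 VbE scalM -mulrA -/k -/be'.
  by rewrite opprD opprB addrC subrK.
(* The factorisation K (1 - X a b) = (1 - z a) (1 - al be) (1 - v b). Each factor on the right has a
   geometric series as inverse, to be multiplied in the reverse order. *)
have XE' : k * (1 - X%:S * fpsC (a * b)) = e * (1 - al * be) * (1 - Vb).
  have -> : e * (1 - al * be) * (1 - Vb) = e * (1 - Vb) - (e * al) * (be * (1 - Vb)).
    by rewrite [e * (1 - al * be)]mulrBr mulr1 [LHS]mulrBl !mulrA.
  rewrite e_al be_Vb VbE (intertwined_expansion _ (KS e)).
  congr (_ * (1 - _)); rewrite /e subKr.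
  rewrite XW scalM rmorphM /= /Ua /be' -!mulrA; congr (_ * _).
  by rewrite !mulrA -fps_scalC.
have S_comp : fps_phi phi (star (X%:S * fpsC (a * b))) = fps_comp mab X.
  rewrite -[star _]mul1r -(rmorph1 (@fpsC A)).
  by apply: fps_phi_resolvent => // j; rewrite mul1r mabE.
have XS0 : (X%:S * fpsC (a * b)) 0%N = 0.
  by rewrite fpsM0 /fps_scal /fps_map X0 /= scale0r mul0r.
have SE : star (X%:S * fpsC (a * b)) = k * (Bv * G * Au).
  have inv : k * (1 - X%:S * fpsC (a * b)) * (Bv * G * Au) = 1.
    rewrite XE' !mulrA -[e * _ * _ * Bv]mulrA (starMl Vb0 : _ * Bv = 1) mulr1.
    rewrite -[e * _ * G]mulrA (starMl albe0 : _ * G = 1) mulr1.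
    exact: starMl.
  set Z := Bv * G * Au in inv *; set Y := X%:S * _ in inv XS0 *.
  have kS : k * star Y = star Y * k by exact: KS.
  by rewrite -[LHS]mulr1 -inv mulrA [_ * (k * _)]mulrA -kS -[k * _ * _]mulrA (starMr XS0)
    mulr1.
(* Written affinely in [al] and [be], the outer factors turn Bv G Au into a scalar combination of G,
   G al, be G and be G al, whose expectations are given by [free_phi_star]. *)
have AuE : Au = ma%:S * (1 + al).
  by rewrite /al addrC subrK mulrA -scalM PK scal1 mul1r.
have BvE : Bv = ma%:S + p%:S * be.
  rewrite /be mulrBr mulr1 !mulrA -scalM mulrA -/v -/Vb.
  have -> : Vb * Bv = Bv - 1.
    by rewrite -(starMl Vb0 : _ * Bv = 1) mulrBl mul1r opprB addrC subrK.
  have -> : ma%:S = 1 + p%:S by rewrite -{1}PE -scal1; exact: rmorphD.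
  by rewrite -[Bv - _ - _]addrA -opprD [RHS]addrC subrK.
have -> : fps_comp mab X = K * fps_phi phi (Bv * G * Au) by rewrite -S_comp SE fps_phiZ.
have -> : Bv * G * Au = ma%:S * ((ma%:S * (G + G * al)) + p%:S * (be * G + be * G * al)).
  rewrite AuE BvE [X in X = _]mulrA -[X in X * _]fps_scalC -mulrA; congr (_ * _).
  rewrite -[_ * G * _]mulrA [G * _]mulrDr mulr1 mulrDl; congr (_ + _).
  by rewrite -[p%:S * be * _]mulrA [be * _]mulrDr [be * (G * al)]mulrA.
rewrite fps_phiZ fps_phiD 2!fps_phiZ 2!fps_phiD G1 bG Ga bGa !addr0 mulr0 addr0 mulr1.
by rewrite mulrA [K * _]mulrC PK mul1r.
Qed.
End FreeMp.

Lemma fps_eqX (A : nzRingType) (f g : fps A) s n :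
  (forall j, (j <= n)%N -> f j = g j) -> forall j, (j <= n)%N -> (f ^+ s) j = (g ^+ s) j.
Proof.
move=> fg; elim: s => [//|s IH] j jn; rewrite !exprS.
by apply: fps_eqM => i ij; [apply: fg | apply: IH]; exact: leq_trans jn.
Qed.

Lemma fps_polyX (A : nzRingType) (p : {poly A}) s :
  ((fun k => p`_k) : fps A) ^+ s = (fun k => (p ^+ s)`_k).
Proof.
elim: s => [|s IH]; apply/funext => k; first by rewrite !expr0 coef1.
by rewrite !exprS IH coefM.
Qed.

Section RealMoments.
Variable R : realType.

(** With cumulants c^(s-1) and y = z M, the cumulant relation sums to M - 1 = y / (1 - c y);
    cancelling one factor z gives [mp_series]. *)
Lemma free_cumulants_mp (c : R) (m : nat -> R) :
  free_cumulants m (fun k => c ^+ k.-1) -> mp_series c (m : fps R).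
Proof.
move=> [m0 mE]; pose M : fps R := m; pose y := fpsX * M.
exists (fun n => m n.+1).
  by apply/funext => -[|n]; rewrite fpsDE fpsXM fps1E ?addr0 ?add0r.
suff ME : M - 1 = y * star (fpsC c * y).
  have y0 : (fpsC c * y) 0%N = 0 by rewrite fpsCM /y fpsXM mulr0.
  have E : (M - 1) * (1 - fpsC c * y) = y by rewrite ME -mulrA (starMr y0) mulr1.
  have M1 : M - 1 = fpsX * (fun n => m n.+1).
    by apply/funext => -[|k]; rewrite fpsBE fpsXM fps1E ?subr0 //= /M m0 subrr.
  apply/funext => n; have := congr1 (fun f : fps R => f n.+1) E.
  by rewrite M1 -mulrA fpsXM /y mulrA fpsXM.
apply/funext => n.
rewrite (@fps_eqM _ y y _ (\sum_(k < n.+1) (fpsC c * y) ^+ k)) //; last first.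
  by move=> j jn; apply: star_trunc; rewrite // fpsCM /y fpsXM mulr0.
case: n => [|n]; first by rewrite fpsBE fps1E fpsM0 /y fpsXM mul0r /M m0 subrr.
rewrite fpsBE fps1E subr0 /M mE // big_add1 big_mkord.
rewrite mulr_sumr fps_sumE [RHS]big_ord_recr /=.
have yk k : (y * (fpsC c * y) ^+ k) n.+1 = c ^+ k * ((y ^+ k.+1) n.+1).
  by rewrite exprMn mulrCA -rmorphXn fpsCM -exprS.
(* The last summand has order n + 2 and does not reach degree n + 1. *)
rewrite yk fpsX_order ?mulr0 ?addr0; last 2 first.
- by rewrite /y fpsXM.
- by [].
apply: eq_bigr => k _; rewrite yk; congr (_ * _).
pose p := \poly_(i < n.+2) m i.
rewrite /y exprMn.
have XnM (f : fps R) s j : (fpsX ^+ s * f) (j + s)%N = f j.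
  by elim: s j => [|s IH] j; rewrite ?expr0 ?mul1r ?addn0 // exprS -mulrA addnS fpsXM IH.
have kn : (k.+1 <= n.+1)%N by exact: ltn_ord.
have -> : (fpsX ^+ k.+1 * M ^+ k.+1) n.+1 = (M ^+ k.+1) (n.+1 - k.+1)%N.
  by have := XnM (M ^+ k.+1) k.+1 (n.+1 - k.+1)%N; rewrite (subnK kn).
have <- := congr1 (fun f => f (n.+1 - k.+1)%N) (fps_polyX p k.+1).
apply: fps_eqX (leqnn _) => j jn; rewrite coef_poly ifT //; lia.
Qed.

(** The free variables live over [R[i]] but the moments are real: the identity is proved over [R[i]]
    and pulled back along the injective embedding of R. *)
Lemma free_mulconv_mp (c : R) (nu mc mu : nat -> R) :
  free_mulconv nu mc mu -> free_cumulants mc (fun k => c ^+ k.-1) ->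
  nu 0%N = 1 /\
  forall X : fps R, X * (1 + fpsC c * ((nu : fps R) - 1)) = fpsX ->
  fps_comp (mu : fps R) X = nu.
Proof.
move=> [A [phi [a [b [phi1 free_ab aE bE abE]]]]] /free_cumulants_mp [N mcN NE].
have injC : injective (real_complex R) by move=> x y [].
pose h : {rmorphism R -> R[i]} := real_complex R.
split; first by apply: injC; have := aE 0%N; rewrite expr0 phi1 rmorph1.
move=> X XE.
suff: fps_map h (fps_comp (mu : fps R) X) = fps_map h (nu : fps R).
  by move=> e; apply/funext => n; apply: injC; exact: (congr1 (fun f : fps R[i] => f n) e).
rewrite fps_map_comp.
apply: (free_mp_comp (c := h c) (mb := fps_map h (mc : fps R)) phi1 free_ab aE bE abE).
  exists (fps_map h N); first by rewrite {1}mcN rmorphD rmorph1 rmorphM /= fps_mapX.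
  by rewrite -{2}NE rmorphM rmorphB rmorph1 !rmorphM /= fps_mapX fps_mapC.
rewrite -[RHS](fps_mapX h) -XE rmorphM rmorphD rmorphM rmorphB !rmorph1.
by rewrite /= fps_mapC.
Qed.

End RealMoments.

(** * The empirical eigenvalue distribution *)

Section AtomicMeasure.
Variable R : realType.

Lemma measurable_subV (t : R) : measurable_fun [set: R] (fun x : R => (x - t)^-1).
Proof.
have -> : [set: R] = [set x | x != t] `|` [set t].
  apply/esym/seteqP; split => // x _ /=.
  by have [->|xt] := eqVneq x t; [right|left].
have mt : measurable [set x : R | x != t].
  have -> : [set x : R | x != t] = ~` [set t] by apply/seteqP; split => x /= /eqP.
  exact: measurableC.
apply/measurable_funU => //; split; last exact: measurable_fun_set1.
apply: subspace_continuous_measurable_fun => //; apply: continuous_in_subspaceT.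
move=> x; rewrite inE /= => xt; apply: cvgV; first by rewrite subr_eq0.
by apply: cvgB; [exact: cvg_id | exact: cvg_cst].
Qed.

(** The formulas for scaled measures and sums of measures are applied to nonnegative functions,
    hence separately to the positive and negative parts of f. *)
Lemma Rintegral_atomic (r : {nonneg R}) (x : nat -> R) n (f : R -> R) :
  measurable_fun [set: R] f ->
  Rintegral (mscale r (msum (fun k => \d_ (x k)) n)) setT f =
  r%:num * \sum_(k < n) f (x k).
Proof.
move=> mf; have mEf : measurable_fun [set: R] (EFin \o f) by exact/measurable_EFinP.
have integral_pos (g : R -> R) : measurable_fun [set: R] g -> (forall y, 0 <= g y) ->
    (\int[mscale r (msum (fun k => \d_ (x k)) n)]_y (g y)%:E =
     (r%:num * \sum_(k < n) g (x k))%:E)%E.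
  move=> mg g0; have mEg : measurable_fun [set: R] (EFin \o g) by exact/measurable_EFinP.
  rewrite ge0_integral_mscale //; last by move=> y _; rewrite lee_fin.
  rewrite ge0_integral_measure_sum //; last by move=> y _; rewrite lee_fin.
  rewrite EFinM -sumEFin; congr (_ * _)%E; apply: eq_bigr => k _.
  by rewrite integral_dirac // diracT mul1e.
rewrite /Rintegral integralE.
have -> : (fun y => (EFin \o f)^\+ y)%E = (fun y => (f^\+ y)%:E) by apply/funext => y;
  rewrite /= funeposE /funrpos -EFin_max.
have -> : (fun y => (EFin \o f)^\- y)%E = (fun y => (f^\- y)%:E) by apply/funext => y;
  rewrite /= funenegE /funrneg -EFin_max.
rewrite (integral_pos _ (measurable_funrpos mf)) ?(integral_pos _ (measurable_funrneg
  mf)) //.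
rewrite -EFinB /= -mulrBr -sumrB; congr (_ * _); apply: eq_bigr => k _.
by have := congr1 (fun g => g (x k)) (funrposBneg f).
Qed.

End AtomicMeasure.

Section Spectrum.
Variable R : realType.
Local Open Scope sesquilinear_scope.

(** Diagonalising by the unitary matrix P, the j-th eigenvalue is N^-1 times the sum over i of |(P
    y_i)_j|^2. *)
Lemma sample_covariance_spectrum_ge0 (n N : nat) (y : 'I_N -> 'cV[R[i]]_n) j :
  0 <= complex.Re (spectral_diag (sample_covariance y) 0 j).
Proof.
set A := sample_covariance y.
have AH : A ^t* = A.
  rewrite /A /sample_covariance linearZ /= linear_sum /= map_mxZ map_mx_sum /=.
  rewrite fmorphV rmorph_nat; congr (_ *: _); apply: eq_bigr => i _.
  by rewrite trmx_mul map_mxM trmxCK.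
have /orthomx_spectralP AE : A \is normalmx by rewrite qualifE /= AH.
set P := spectralmx A in AE; set D := spectral_diag A in AE *.
have PU : P \is unitarymx by exact: spectral_unitarymx.
have DE : diag_mx D = P *m A *m P ^t*.
  rewrite {1}AE -(invmx_unitary PU) !mulmxA mulmxV ?mul1mx ?unitarymx_unit //.
  by rewrite mulmxK // unitarymx_unit.
have Djj : D 0 j = N%:R^-1 * \sum_i `|(P *m y i) j 0| ^+ 2.
  have -> : D 0 j = (diag_mx D) j j by rewrite mxE eqxx mulr1n.
  rewrite DE /A /sample_covariance -scalemxAr -scalemxAl mxE; congr (_ * _).
  rewrite mulmx_sumr mulmx_suml summxE; apply: eq_bigr => i _.
  have -> : P *m (y i *m (y i) ^t*) *m P ^t* = (P *m y i) *m (P *m y i) ^t*.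
    by rewrite trmx_mul map_mxM !mulmxA.
  by rewrite mxE big_ord1 [X in _ * X]mxE [X in _ * X^*]mxE normCK.
have : 0 <= D 0 j.
  rewrite Djj; apply: mulr_ge0; first by rewrite invr_ge0 ler0n.
  by apply: sumr_ge0 => i _; apply: exprn_ge0; exact: normr_ge0.
by rewrite lecE => /andP[].
Qed.

End Spectrum.

(** * Convergent power series *)

Section PowerSeries.
Variable R : realType.
Implicit Types (a b : fps R) (e r : R).

Definition psum a e n : R := \sum_(k < n) a k * e ^+ k.
Definition fps_abs a : fps R := fun k => `|a k|.
(** Absolute convergence at radius r, encoded by bounded partial sums so that estimates on
    recursively defined coefficients apply directly. *)
Definition ell1 r a := exists K, forall n, psum (fps_abs a) r n <= K.
Definition ev a e : R := limn (psum a e).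

Lemma series_psum a e : series (fun k => a k * e ^+ k) = psum a e.
Proof. by apply/funext => n; rewrite /series /= big_mkord. Qed.

Lemma psumS a e n : psum a e n.+1 = psum a e n + a n * e ^+ n.
Proof. by rewrite /psum big_ord_recr. Qed.

Lemma psumD a b e n : psum (a + b) e n = psum a e n + psum b e n.
Proof. by rewrite /psum -big_split; apply: eq_bigr => k _; rewrite fpsDE mulrDl. Qed.

Lemma psumN a e n : psum (- a) e n = - psum a e n.
Proof. by rewrite /psum -sumrN; apply: eq_bigr => k _; rewrite fpsNE mulNr. Qed.

Lemma psum_nneg a e n : (forall k, 0 <= a k) -> 0 <= e -> 0 <= psum a e n.
Proof. by move=> a0 e0; apply: sumr_ge0 => k _; rewrite mulr_ge0 ?exprn_ge0. Qed.

Lemma psum_nd a e : (forall k, 0 <= a k) -> 0 <= e -> nondecreasing_seq (psum a e).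
Proof.
move=> a0 e0; apply/nondecreasing_seqP => n.
by rewrite psumS lerDl mulr_ge0 ?exprn_ge0.
Qed.

Lemma fps_absE a k : fps_abs a k = `|a k|. Proof. by []. Qed.

Lemma psum_norm a e n : `|psum a e n| <= psum (fps_abs a) `|e| n.
Proof.
apply: le_trans (ler_norm_sum _ _ _) _; apply: ler_sum => k _.
by rewrite normrM normrX.
Qed.

Lemma psum_le a b e n : (forall k, a k <= b k) -> 0 <= e -> psum a e n <= psum b e n.
Proof. by move=> ab e0; apply: ler_sum => k _; rewrite ler_wpM2r ?exprn_ge0. Qed.

Lemma psum_leX a e r n : (forall k, 0 <= a k) -> 0 <= e -> e <= r ->
  psum a e n <= psum a r n.
Proof. by move=> a0 e0 er; apply: ler_sum => k _;
  rewrite ler_wpM2l // lerXn2r // ?nnegrE // (le_trans e0). Qed.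

Let pm n a : {poly R} := \poly_(k < n) a k.

(** In the product of two truncations the coefficients below n are those of the Cauchy product; the
    second sum is the overshoot. *)
Lemma psumM a b e n : psum a e n * psum b e n =
  psum (a * b) e n + \sum_(n <= k < n + n) (pm n a * pm n b)`_k * e ^+ k.
Proof.
have pmE (f : fps R) : psum f e n = (pm n f).[e] by rewrite /psum /pm horner_poly.
have sz : (size (pm n a * pm n b)%R <= n + n)%N.
  apply: leq_trans (size_polyMleq _ _) _.
  by have := size_poly n a; have := size_poly n b; rewrite -/(pm n a) -/(pm n b); lia.
rewrite [in LHS]pmE pmE -hornerM (horner_coef_wide _ sz) -(big_mkord xpredT (fun k =>
  (pm n a * pm n b)`_k * e ^+ k)).
rewrite (big_cat_nat (n := n)) //= ?leq_addr //; congr (_ + _).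
rewrite big_mkord; apply: eq_bigr => k _; congr (_ * _).
rewrite coefM fpsME; apply: eq_bigr => j _.
by have := ltn_ord j; have := ltn_ord k => kn jk; rewrite !coef_poly !ifT //; lia.
Qed.

Lemma psumM_le a b e n : (forall k, 0 <= a k) -> (forall k, 0 <= b k) -> 0 <= e ->
  psum (a * b) e n <= psum a e n * psum b e n <= psum (a * b) e (n + n).
Proof.
move=> a0 b0 e0.
have pm0 (f : fps R) (f0 : forall k, 0 <= f k) k : 0 <= (pm n f)`_k <= f k.
  by rewrite coef_poly; case: ifP => _; rewrite ?lexx ?f0.
have pmM k : 0 <= (pm n a * pm n b)`_k <= (a * b) k.
  rewrite coefM fpsME sumr_ge0 /=; last first.
    by move=> j _; have /andP[? _] := pm0 a a0 j; have /andP[? _] := pm0 b b0 (k - j)%N;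
      rewrite mulr_ge0.
  apply: ler_sum => j _; have /andP[? ?] := pm0 a a0 j;
    have /andP[? ?] := pm0 b b0 (k - j)%N.
  exact: ler_pM.
rewrite psumM; apply/andP; split.
  rewrite lerDl sumr_ge0 // => k _; have /andP[? _] := pmM k.
  by rewrite mulr_ge0 ?exprn_ge0.
rewrite {2}/psum -(big_mkord xpredT (fun k => (a * b) k * e ^+ k)).
rewrite [leRHS](big_cat_nat (n := n)) //= ?leq_addr //
  big_mkord -/(psum (a * b) e n) lerD2l.
apply: ler_sum => k _; have /andP[_ ?] := pmM k.
by rewrite ler_wpM2r ?exprn_ge0.
Qed.

Lemma fps_absM a b k : (fps_abs (a * b)) k <= (fps_abs a * fps_abs b) k.
Proof.
rewrite fps_absE !fpsME; apply: le_trans (ler_norm_sum _ _ _) _.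
by apply: ler_sum => j _; rewrite normrM.
Qed.

Lemma psumM_dist a b e n : `|psum a e n * psum b e n - psum (a * b) e n| <=
  psum (fps_abs a) `|e| n * psum (fps_abs b) `|e| n - psum (fps_abs a * fps_abs b) `|e| n.
Proof.
rewrite !psumM ![psum _ _ _ + _]addrC !addrK.
apply: le_trans (ler_norm_sum _ _ _) _; apply: ler_sum => k _.
rewrite normrM normrX ler_wpM2r ?exprn_ge0 //.
rewrite !coefM; apply: le_trans (ler_norm_sum _ _ _) _; apply: ler_sum => j _.
by rewrite normrM !coef_poly; do 2![case: ifP => _]; rewrite ?normr0.
Qed.

Lemma ell1_le r a b : (forall k, `|a k| <= `|b k|) -> 0 <= r -> ell1 r b -> ell1 r a.
Proof.
by move=> ab r0 [K bK]; exists K => n; apply: le_trans (bK n); exact: psum_le.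
Qed.

Lemma ell1_leX r e a : 0 <= e -> e <= r -> ell1 r a -> ell1 e a.
Proof.
move=> e0 er [K aK]; exists K => n; apply: le_trans (aK n); apply: psum_leX => //.
by move=> k; rewrite fps_absE.
Qed.

Lemma ell1D r a b : 0 <= r -> ell1 r a -> ell1 r b -> ell1 r (a + b).
Proof.
move=> r0 [K aK] [L bL]; exists (K + L) => n.
apply: le_trans (lerD (aK n) (bL n)); rewrite -psumD.
by apply: psum_le => // k; rewrite fpsDE !fps_absE fpsDE ler_normD.
Qed.

Lemma ell1N r a : ell1 r a -> ell1 r (- a).
Proof.
move=> [K aK]; exists K => n; suff -> : fps_abs (- a) = fps_abs a by [].
by apply/funext => k; rewrite !fps_absE fpsNE normrN.
Qed.

Lemma ell1B r a b : 0 <= r -> ell1 r a -> ell1 r b -> ell1 r (a - b).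
Proof. by move=> r0 ha hb; apply: ell1D => //; exact: ell1N. Qed.

Lemma ell1M r a b : 0 <= r -> ell1 r a -> ell1 r b -> ell1 r (a * b).
Proof.
move=> r0 [K aK] [L bL]; exists (K * L) => n.
have abs0 (f : fps R) k : 0 <= fps_abs f k by rewrite fps_absE.
apply: (@le_trans _ _ (psum (fps_abs a * fps_abs b) r n)).
  by apply: psum_le => // k; exact: fps_absM.
have /andP[/le_trans + _] := psumM_le n (abs0 a) (abs0 b) r0; apply.
by apply: ler_pM; rewrite ?psum_nneg.
Qed.

Lemma psumC c e n : psum (fpsC c) e n.+1 = c.
Proof.
rewrite /psum big_ord_recl mulr1 big1 ?addr0 // => i _; exact: mul0r.
Qed.

Lemma ell1C r c : ell1 r (fpsC c).
Proof.
exists `|c|; case=> [|n]; first by rewrite /psum big_ord0.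
suff -> : fps_abs (fpsC c) = fpsC `|c| by rewrite psumC.
by apply/funext => -[|k]; rewrite fps_absE //= normr0.
Qed.

Lemma ell1_1 r : ell1 r 1.
Proof. by rewrite -(rmorph1 (@fpsC R)); exact: ell1C. Qed.

Lemma psumX e n : psum fpsX e n.+2 = e.
Proof.
rewrite /psum 2!big_ord_recl /= mul0r add0r mul1r expr1 big1 ?addr0 // => i _.
by rewrite mul0r.
Qed.

Lemma ell1X r : 0 <= r -> ell1 r fpsX.
Proof.
move=> r0; exists r => n.
have -> : fps_abs (fpsX : fps R) = fpsX by apply/funext => k;
  rewrite fps_absE /fpsX ger0_norm.
apply: (@le_trans _ _ (psum fpsX r n.+2)); last by rewrite psumX.
by apply: psum_nd => //; exact: leqW.
Qed.

Lemma ell1_sum r (I : Type) (s : seq I) (P : pred I) (F : I -> fps R) : 0 <= r ->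
  (forall i, ell1 r (F i)) -> ell1 r (\sum_(i <- s | P i) F i).
Proof.
move=> r0 hF; elim/big_rec : _ => [|i x _ hx]; last exact: ell1D.
by rewrite -(rmorph0 (@fpsC R)); exact: ell1C.
Qed.

Lemma ell1_cvg_nneg a e : (forall k, 0 <= a k) -> 0 <= e -> ell1 e a -> cvgn (psum a e).
Proof.
move=> a0 e0 [K aK]; apply: nondecreasing_is_cvgn; first exact: psum_nd.
exists K => _ [n _ <-]; apply: le_trans (aK n).
by apply: psum_le => // k; rewrite fps_absE ler_norm.
Qed.

Lemma ev_cvg r a e : `|e| <= r -> ell1 r a -> psum a e @ \oo --> ev a e.
Proof.
move=> er /(ell1_leX (normr_ge0 e) er) ha.
suff : cvgn (psum a e) by [].
rewrite -series_psum; apply: normed_cvg.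
have -> : [normed series (fun k => a k * e ^+ k)] = psum (fps_abs a) `|e|.
  apply/funext => n; rewrite /= /series /= big_mkord.
  by apply: eq_bigr => k _; rewrite normrM normrX.
apply: ell1_cvg_nneg => //; first by move=> k; rewrite fps_absE.
apply: ell1_le ha => // k; by rewrite fps_absE normr_id.
Qed.

Lemma ev_unique a e l : psum a e @ \oo --> l -> ev a e = l.
Proof. by move=> /cvg_lim; apply. Qed.

Lemma evD r a b e : `|e| <= r -> ell1 r a -> ell1 r b -> ev (a + b) e = ev a e + ev b e.
Proof.
move=> er ha hb; apply: ev_unique.
rewrite (_ : psum (a + b) e = psum a e \+ psum b e); last by apply/funext => n;
  rewrite psumD.
by apply: cvgD; exact: ev_cvg er _.
Qed.

Lemma evN r a e : `|e| <= r -> ell1 r a -> ev (- a) e = - ev a e.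
Proof.
move=> er ha; apply: ev_unique.
rewrite (_ : psum (- a) e = \- psum a e); last by apply/funext => n; rewrite psumN.
by apply: cvgN; exact: ev_cvg er _.
Qed.

Lemma evB r a b e : `|e| <= r -> ell1 r a -> ell1 r b -> ev (a - b) e = ev a e - ev b e.
Proof. by move=> er ha hb; rewrite (evD er) ?(evN er) //; exact: ell1N. Qed.

Lemma evC c e : ev (fpsC c) e = c.
Proof.
apply: ev_unique; rewrite -(cvg_shiftS (psum (fpsC c) e)).
rewrite (_ : [sequence _]_n = cst c); last by apply/funext => n /=; rewrite psumC.
exact: cvg_cst.
Qed.

Lemma ev1 e : ev 1 e = 1.
Proof. by rewrite -(rmorph1 (@fpsC R)) evC. Qed.

Lemma evX e : ev fpsX e = e.
Proof.
apply: ev_unique; rewrite -(cvg_shiftn 2).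
rewrite (_ : [sequence _]_n = cst e); last by apply/funext => n /=; rewrite addn2 psumX.
exact: cvg_cst.
Qed.

(** For the series of absolute values the overshoot of [psumM] tends to 0, since [psumM_le] squeezes
    the product of partial sums between partial sums of the product. By [psumM_dist] it dominates
    the overshoot for a and b. *)
Lemma evM r a b e : `|e| <= r -> ell1 r a -> ell1 r b -> ev (a * b) e = ev a e * ev b e.
Proof.
move=> er ha hb; apply/esym/eqP; rewrite -subr_eq0; apply/eqP.
have r0 : 0 <= r by exact: le_trans er.
have e0 : 0 <= `|e| by exact: normr_ge0.
have ha' := ell1_leX e0 er ha; have hb' := ell1_leX e0 er hb.
have abs0 (f : fps R) k : 0 <= fps_abs f k by rewrite fps_absE.
have habs (f : fps R) : ell1 `|e| f -> ell1 `|e| (fps_abs f).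
  by apply: ell1_le => // k; rewrite fps_absE normr_id.
have ab0 k : 0 <= (fps_abs a * fps_abs b) k by rewrite fpsME sumr_ge0 // => j _;
  rewrite mulr_ge0.
have ca := ell1_cvg_nneg (abs0 a) e0 (habs _ ha').
have cb := ell1_cvg_nneg (abs0 b) e0 (habs _ hb').
have cab := ell1_cvg_nneg ab0 e0 (ell1M e0 (habs _ ha') (habs _ hb')).
set A := psum (fps_abs a) `|e| in ca; set B := psum (fps_abs b) `|e| in cb.
set D := psum (fps_abs a * fps_abs b) `|e| in cab.
have cAB : (fun n => A n * B n) @ \oo --> limn A * limn B by exact: cvgM.
have lAB : limn A * limn B = limn D.
  apply/le_anti/andP; split.
    rewrite -(cvg_lim _ cAB) //; apply: limr_le; first by apply/cvg_ex; eexists; exact: cAB.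
    apply: nearW => n; have /andP[_ /le_trans] := psumM_le n (abs0 a) (abs0 b) e0; apply.
    by apply: nondecreasing_cvgn_le => //; exact: psum_nd.
  rewrite -(cvg_lim _ cAB) //; apply: ler_lim => //; first by apply/cvg_ex; eexists;
    exact: cAB.
  by apply: nearW => n; have /andP[] := psumM_le n (abs0 a) (abs0 b) e0.
have cD : (fun n => A n * B n - D n) @ \oo --> 0.
  by rewrite -(subrr (limn D)) -{1}lAB; apply: cvgB.
have c1 : (fun n => psum a e n * psum b e n - psum (a * b) e n) @ \oo --> ev a e * ev b e
  - ev (a * b) e.
  by apply: cvgB; [apply: cvgM|]; apply: ev_cvg er _ => //; exact: ell1M.
apply: (cvg_unique _ c1); first exact: norm_hausdorff.
apply/cvgr0Pnorm_le => eps eps0; move/cvgr0Pnorm_le : cD => /(_ eps eps0).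
apply: filterS => n; apply: le_trans; apply: le_trans (psumM_dist _ _ _ _) _.
exact: ler_norm.
Qed.

Lemma ev_sum r (I : Type) (s : seq I) (P : pred I) (F : I -> fps R) e : `|e| <= r ->
  (forall i, ell1 r (F i)) -> ev (\sum_(i <- s | P i) F i) e =
    \sum_(i <- s | P i) ev (F i) e.
Proof.
move=> er hF; have r0 : 0 <= r by exact: le_trans er.
suff [] : ev (\sum_(i <- s | P i) F i) e = \sum_(i <- s | P i) ev (F i) e /\
    ell1 r (\sum_(i <- s | P i) F i) by [].
elim/big_rec2 : _ => [|i y x _ [<- hx]].
  by rewrite -(rmorph0 (@fpsC R)) evC; split => //; exact: ell1C.
by rewrite (evD er) //; split => //; exact: ell1D.
Qed.

Lemma ev_bounded r a : 0 <= r -> ell1 r a ->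
  exists2 K, 0 <= K & forall e, `|e| <= r -> `|ev a e| <= K.
Proof.
move=> r0 ha; have [K aK] := ha; exists K; first by have := aK 0%N; rewrite /psum big_ord0.
move=> e er; have c := ev_cvg er ha; rewrite -(cvg_lim _ (cvg_norm c)) //.
apply: limr_le; first by apply/cvg_ex; eexists; exact: (cvg_norm c).
apply: nearW => n; apply: le_trans (psum_norm _ _ _) _.
apply: le_trans (aK n); apply: psum_leX => // k; by rewrite fps_absE.
Qed.

End PowerSeries.

(** * Quadratic systems of power series *)

(** Under iteration of F the value at n is fixed after n + 1 steps, whatever the start; the diagonal
    of the iterates is the fixed point. *)
Lemma causal_fixpoint (T : Type) (t0 : T) (F : (nat -> T) -> nat -> T) :
  (forall f g n, (forall k, (k < n)%N -> f k = g k) -> F f n = F g n) ->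
  exists f, forall n, f n = F f n.
Proof.
move=> Fcausal; pose it m := iter m F (fun=> t0).
have stable m1 m2 n : (n < m1)%N -> (n < m2)%N -> it m1 n = it m2 n.
  elim/ltn_ind: n m1 m2 => n IH [|m1] [|m2] //= nm1 nm2.
  by apply: Fcausal => k kn; apply: IH => //; exact: leq_trans kn _.
exists (fun n => it n.+1 n) => n /=; apply: Fcausal => k kn.
exact: (stable n k.+1 k kn (ltnSn k)).
Qed.

Section QuadraticSystem.
Variables (R : realType) (I : finType).
Variables (L0 : fps R) (L : I -> fps R) (b0 : I -> R) (B : I -> I -> R).

(** The factor [fpsX] in front of the quadratic terms makes each coefficient depend on earlier ones
    only. *)
Definition quadratic_system (X : fps R) (Q : I -> fps R) : Prop :=
  X = L0 + fpsX * X * (\sum_k fpsC (b0 k) * Q k) /\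
  forall i, Q i = L i + fpsX * X * (\sum_k fpsC (B i k) * Q k).

Lemma quadratic_system_exists : exists X Q, quadratic_system X Q.
Proof.
pose X_ (f : nat -> R * (I -> R)) : fps R := fun k => (f k).1.
pose Q_ (f : nat -> R * (I -> R)) i : fps R := fun k => (f k).2 i.
pose rhs (l : fps R) (b : I -> R) f := l + fpsX * X_ f * (\sum_k fpsC (b k) * Q_ f k).
have [|f fE] := @causal_fixpoint _ (0, fun=> 0)
   (fun f n => (rhs L0 b0 f n, fun i => rhs (L i) (B i) f n)).
  move=> f g n fg.
  suff rhs_fg l b : rhs l b f n = rhs l b g n.
    by rewrite rhs_fg; congr (_, _); apply/funext => i; rewrite rhs_fg.
  rewrite /rhs !fpsDE -!mulrA !fpsXM; case: n fg => // n fg.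
  congr (_ + _); apply: fps_eqM => j jn; first by rewrite /X_ fg.
  rewrite !fps_sumE; apply: eq_bigr => k _.
  by rewrite !fpsCM /Q_ fg.
exists (X_ f), (Q_ f); split=> [|i]; apply/funext => n.
  by rewrite {1}/X_ fE.
by rewrite {1}/Q_ fE.
Qed.

Lemma psum_shift (a : fps R) r n : psum (fpsX * a) r n.+1 = r * psum a r n.
Proof.
rewrite /psum big_ord_recl fpsXM mul0r add0r mulr_sumr; apply: eq_bigr => i _.
by rewrite fpsXM /= exprS mulrCA.
Qed.

(* S <= F + beta r S^2 keeps the partial sums S below 2 F as soon as
   4 beta r F <= 1. *)
Lemma quadratic_bound (y l : fps R) (beta r0 F : R) :
  (forall k, 0 <= y k) -> (forall k, 0 <= l k) -> 0 <= beta -> 0 < r0 ->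
  (forall n, psum l r0 n <= F) ->
  (forall k, y k <= l k + beta * (fpsX * (y * y)) k) ->
  exists2 r, 0 < r & forall n, psum y r n <= 2 * F.
Proof.
move=> y0 l0 beta0 r00 lF yle.
have F0 : 0 <= F by have := lF 0%N; rewrite /psum big_ord0.
(* The summand 1 keeps the denominator positive when beta or F vanishes, and still gives 4 beta F r
   <= 1. *)
pose r := Num.min r0 (4 * beta * F + 1)^-1.
have den0 : 0 < 4 * beta * F + 1 by rewrite ltr_wpDl // !mulr_ge0.
have r_gt0 : 0 < r by rewrite lt_min r00 invr_gt0.
have rle : 4 * beta * F * r <= 1.
  have : r * (4 * beta * F + 1) <= 1.
    by rewrite -ler_pdivlMr // mul1r ge_min lexx orbT.
  have := ltW r_gt0; nra.
exists r => //; elim=> [|n IH]; first by rewrite /psum big_ord0 mulr_ge0.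
apply: (@le_trans _ _ (psum (l + fpsC beta * (fpsX * (y * y))) r n.+1)).
  by apply: psum_le => [k|]; rewrite ?fpsDE ?fpsCM // ltW.
have -> : fpsC beta * (fpsX * (y * y)) = fpsX * (fpsC beta * (y * y)) by ring.
rewrite psumD psum_shift.
have -> : psum (fpsC beta * (y * y)) r n = beta * psum (y * y) r n.
  by rewrite /psum mulr_sumr; apply: eq_bigr => k _; rewrite fpsCM mulrA.
have S1 : psum l r n.+1 <= F.
  by apply: le_trans (lF n.+1); apply: psum_leX => //;
    [exact: ltW | rewrite /r ge_min lexx].
have /andP[S2 _] := psumM_le n y0 y0 (ltW r_gt0).
have S0 : 0 <= psum y r n by apply: psum_nneg => //; exact: ltW.
have S3 : psum (y * y) r n <= 2 * F * (2 * F) by apply: le_trans S2 _; exact: ler_pM.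
have S4 : r * (beta * psum (y * y) r n) <= r * (beta * (2 * F * (2 * F))).
  by apply: ler_wpM2l; [exact: ltW | exact: ler_wpM2l].
nra.
Qed.

(** The sum y of the absolute values of all unknowns satisfies coefficientwise y <= l + beta z y^2,
    to which [quadratic_bound] applies. Here beta is [beta0] counted once for X and once for each
    Q_i, and [beta0] bounds every coefficient of the system. *)
Lemma quadratic_system_ell1 r X Q : 0 < r -> ell1 r L0 -> (forall i, ell1 r (L i)) ->
  quadratic_system X Q ->
  exists r', [/\ 0 < r', ell1 r' X & forall i, ell1 r' (Q i)].
Proof.
move=> r0 hL0 hL [XE QE].
have r_ge0 := ltW r0.
pose y : fps R := fps_abs X + \sum_i fps_abs (Q i).
pose l : fps R := fps_abs L0 + \sum_i fps_abs (L i).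
have abs0 (f : fps R) k : 0 <= fps_abs f k by rewrite fps_absE.
have sum0 (f : I -> fps R) k : 0 <= (\sum_i fps_abs (f i)) k.
  by rewrite fps_sumE sumr_ge0.
pose beta0 := \sum_k `|b0 k| + \sum_i \sum_k `|B i k|.
have beta0_ge0 : 0 <= beta0.
  by rewrite addr_ge0 ?sumr_ge0 // => i _; rewrite sumr_ge0.
have [F lF] : exists F, forall n, psum l r n <= F.
  have habs (f : fps R) : ell1 r f -> ell1 r (fps_abs f).
    by apply: ell1_le => // k; rewrite fps_absE normr_id.
  have [K lK] : ell1 r l.
    by apply: ell1D => //; [exact: habs | apply: ell1_sum => // i; exact: habs].
  exists K => n; apply: le_trans (lK n); apply: psum_le => // k.
  by rewrite fps_absE ler_norm.
have Xy k : `|X k| <= y k by rewrite /y fpsDE fps_absE lerDl.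
have Qy k : \sum_i `|Q i k| <= y k.
  rewrite /y fpsDE fps_sumE fps_absE lerDr //.
have y0 k : 0 <= y k by exact: le_trans (Xy k).
have yy0 k : 0 <= (fpsX * (y * y)) k.
  by rewrite fpsXM; case: k => // k; rewrite fpsME sumr_ge0 // => j _; rewrite mulr_ge0.
have rhs_le (f : fps R) (b : I -> R) k : (forall k, `|b k| <= beta0) ->
    `|(f + fpsX * X * (\sum_k fpsC (b k) * Q k)) k| <=
    fps_abs f k + beta0 * (fpsX * (y * y)) k.
  move=> bb; rewrite fpsDE; apply: le_trans (ler_normD _ _) _; rewrite lerD2l.
  rewrite -mulrA !fpsXM; case: k => [|k]; first by rewrite normr0 mulr0.
  rewrite !fpsME mulr_sumr; apply: le_trans (ler_norm_sum _ _ _) _.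
  apply: ler_sum => j _; rewrite normrM fps_sumE mulrCA ler_pM //.
  apply: le_trans (ler_norm_sum _ _ _) _.
  apply: (@le_trans _ _ (beta0 * \sum_i `|Q i (k - j)%N|)); last exact: ler_wpM2l.
  by rewrite mulr_sumr; apply: ler_sum => i _; rewrite fpsCM normrM ler_wpM2r.
have b0_le k : `|b0 k| <= beta0.
  rewrite /beta0 (bigD1 k) //= -addrA lerDl addr_ge0 ?sumr_ge0 // => i _.
  by rewrite sumr_ge0.
have B_le i k : `|B i k| <= beta0.
  apply: (@le_trans _ _ (\sum_k `|B i k|)); first by rewrite (bigD1 k) //= lerDl sumr_ge0.
  apply: (@le_trans _ _ (\sum_i \sum_k `|B i k|)).
    rewrite [leRHS](bigD1 i) //= lerDl sumr_ge0 // => j _; exact: sumr_ge0.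
  by rewrite /beta0 lerDr sumr_ge0.
have l_ge0 k : 0 <= l k by rewrite /l fpsDE addr_ge0.
have beta_ge0 : 0 <= (1 + #|I|%:R) * beta0 by rewrite mulr_ge0 // addr_ge0 ?ler0n.
have [|r' r'0 yF] := quadratic_bound y0 l_ge0 beta_ge0 r0 lF.
- move=> k; rewrite {1}/y /l !fpsDE !fps_sumE fps_absE.
  rewrite XE.
  have := rhs_le L0 b0 k b0_le.
  have : \sum_i fps_abs (Q i) k <= \sum_i fps_abs (L i) k +
      #|I|%:R * (beta0 * (fpsX * (y * y)) k).
    rewrite [#|I|%:R * _]mulr_natl -sumr_const -big_split /=.
    by apply: ler_sum => i _; rewrite {1}QE; exact: rhs_le.
  lra.
- exists r'; split=> // [|i]; exists (2 * F) => n; apply: le_trans (yF n).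
    by apply: psum_le (ltW r'0) => k; exact: Xy.
  apply: psum_le (ltW r'0) => k; apply: le_trans (Qy k).
  by rewrite (bigD1 i) //= lerDl sumr_ge0.
Qed.

End QuadraticSystem.

(** * Local solutions of the equation U(x) = u *)

Section Germs.
Variables (R : realType) (n : nat) (lam : 'I_n -> R) (c : R).

Definition fps_avg (F : 'I_n -> fps R) : fps R := fpsC n%:R^-1 * \sum_j F j.
Definition avg (f : 'I_n -> R) : R := n%:R^-1 * \sum_j f j.

(* The equation U(x) = u between x = 1 / theta(w) and u = 1 / w, with
   Q_j = 1 / (1 - lam_j x) as auxiliary unknowns to make it quadratic. *)
Definition germ_eqs (X : fps R) (Q : 'I_n -> fps R) (U : fps R) : Prop :=
  X * (1 + fpsC c * (fps_avg Q - 1)) = U /\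
  forall j, Q j * (1 - fpsC (lam j) * X) = 1.

Lemma fps_avgD F G : fps_avg (fun j => F j + G j) = fps_avg F + fps_avg G.
Proof. by rewrite /fps_avg big_split mulrDr. Qed.

Lemma fps_avgZ A F : fps_avg (fun j => A * F j) = A * fps_avg F.
Proof. by rewrite /fps_avg -mulr_sumr mulrCA. Qed.

Lemma fps_avgC f : fps_avg (fun j => fpsC (f j)) = fpsC (avg f).
Proof. by rewrite /fps_avg /avg rmorphM rmorph_sum. Qed.

Lemma fpsX_inj : injective (fun F : fps R => fpsX * F).
Proof.
move=> F G /= FG; apply/funext => k; have := congr1 (fun f : fps R => f k.+1) FG.
by rewrite !fpsXM.
Qed.

Variables (x0 u0 : R) (q0 : 'I_n -> R) (u' : fps R).
(* The derivative U'(x0). *)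
Definition germ_det : R := 1 + c * (avg q0 - 1) + c * x0 * avg (fun j => lam j * q0 j ^+ 2).

(* The system obtained for x0 + z X' and q0_j + z Q'_j after solving for the terms
   linear in X' and Q', which is possible as germ_det is nonzero. *)
Definition germ_L0 : fps R := fpsC germ_det^-1 * u'.
Definition germ_L j : fps R := fpsC (lam j * q0 j ^+ 2) * germ_L0.
Definition germ_b (k : 'I_n) : R :=
  - (c * germ_det^-1 * (1 + x0 * (lam k * q0 k)) * n%:R^-1).
Definition germ_B (i k : 'I_n) : R :=
  lam i * q0 i ^+ 2 * germ_b k + lam i * q0 i * (i == k)%:R.

Hypothesis xE : x0 * (1 + c * (avg q0 - 1)) = u0.
Hypothesis qE : forall j, q0 j * (1 - lam j * x0) = 1.
Hypothesis d0 : germ_det != 0.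
Variables (X' : fps R) (Q' : 'I_n -> fps R).

(** Both sides amount to G = 0 and E_j = 0 for all j. By [F1] and [F2] the residuals of the germ
    equations are z E_j, up to the unit q0_j, and z (G + c x0 avg E); the system is G divided by
    [germ_det], with the resulting X' substituted in E_j. One direction builds a solution near a
    finite point, the other proves convergence of a known formal solution. *)
Lemma germ_eqs_quadratic :
  germ_eqs (fpsC x0 + fpsX * X') (fun j => fpsC (q0 j) + fpsX * Q' j) (fpsC u0 + fpsX * u')
  <-> quadratic_system germ_L0 germ_L germ_b germ_B X' Q'.
Proof.
pose P := fps_avg Q'; pose S := fps_avg (fun j => fpsC (lam j * q0 j) * Q' j).
pose E j := Q' j - fpsC (lam j * q0 j ^+ 2) * X' - fpsC (lam j * q0 j) * (fpsX * Q' j * X').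
pose G := fpsC germ_det * X' - u' + fpsX * X' * (fpsC c * (P + fpsC x0 * S)).
have PE : P = fps_avg E + fpsC (avg (fun j => lam j * q0 j ^+ 2)) * X' + fpsX * X' * S.
  rewrite -fps_avgC [_ * X']mulrC -!fps_avgZ -!fps_avgD; congr fps_avg.
  by apply/funext => j; rewrite /E; ring.
have F1 j : fpsC (q0 j) *
    ((fpsC (q0 j) + fpsX * Q' j) * (1 - fpsC (lam j) * (fpsC x0 + fpsX * X')) - 1)
    = fpsX * E j.
  have q1 : fpsC (q0 j) * (1 - fpsC (lam j) * fpsC x0) = 1.
    by rewrite -rmorphM -(rmorph1 (@fpsC R)) -rmorphB -rmorphM qE.
  rewrite /E expr2 !rmorphM.
  transitivity (fpsC (q0 j) * (fpsC (q0 j) * (1 - fpsC (lam j) * fpsC x0) - 1)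
    + fpsX * (fpsC (q0 j) * (1 - fpsC (lam j) * fpsC x0) * Q' j
       - fpsC (lam j) * (fpsC (q0 j) * fpsC (q0 j)) * X'
       - fpsC (lam j) * fpsC (q0 j) * (fpsX * Q' j * X'))); first by ring.
  by rewrite q1; ring.
have F2 : (fpsC x0 + fpsX * X') *
    (1 + fpsC c * (fps_avg (fun j => fpsC (q0 j) + fpsX * Q' j) - 1))
    - (fpsC u0 + fpsX * u') = fpsX * (G + fpsC c * fpsC x0 * fps_avg E).
  rewrite fps_avgD fps_avgZ fps_avgC -/P /G.
  have -> : fps_avg E = P - fpsC (avg (fun j => lam j * q0 j ^+ 2)) * X' - fpsX * X' * S.
    by rewrite PE; ring.
  rewrite -xE /germ_det !(rmorphM, rmorphD, rmorphB, rmorph1) /=.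
  by ring.
have d1 : fpsC germ_det * fpsC germ_det^-1 = 1 by rewrite -rmorphM mulfV // rmorph1.
have bE : \sum_k fpsC (germ_b k) * Q' k = - (fpsC germ_det^-1 * fpsC c * (P + fpsC x0 * S)).
  rewrite -[fpsC x0 * S]fps_avgZ -fps_avgD /fps_avg mulrCA mulr_sumr mulr_sumr -sumrN.
  by apply: eq_bigr => k _; rewrite /germ_b !(rmorphN, rmorphM, rmorphD, rmorph1) /=; ring.
have BE i : \sum_k fpsC (germ_B i k) * Q' k =
    fpsC (lam i * q0 i ^+ 2) * (\sum_k fpsC (germ_b k) * Q' k) + fpsC (lam i * q0 i) * Q' i.
  rewrite mulr_sumr -[_ * Q' i](_ : \sum_k fpsC (lam i * q0 i * (i == k)%:R) * Q' k = _).
    rewrite -big_split /=; apply: eq_bigr => k _.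
    rewrite mulrA -mulrDl; congr (_ * _).
    by rewrite -rmorphM -rmorphD.
  rewrite (bigD1 i) //= eqxx mulr1 big1 ?addr0 // => k /negPf ki.
  by rewrite eq_sym ki mulr0 rmorph0 mul0r.
have sysG : X' = germ_L0 + fpsX * X' * (\sum_k fpsC (germ_b k) * Q' k) <-> G = 0.
  have dG : fpsC germ_det * (X' - (germ_L0 + fpsX * X' * (\sum_k fpsC (germ_b k) * Q'
    k))) = G.
    transitivity (fpsC germ_det * X' - (fpsC germ_det * fpsC germ_det^-1) * u'
      + fpsX * X' * ((fpsC germ_det * fpsC germ_det^-1) * fpsC c * (P + fpsC x0 * S))).
      by rewrite bE /germ_L0; ring.
    by rewrite d1 /G; ring.
  split=> [XE|G0]; first by rewrite -dG -XE subrr mulr0.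
  apply/eqP; rewrite -subr_eq0; apply/eqP.
  by rewrite -[LHS]mul1r -d1 mulrAC dG G0 mul0r.
have sysE i : X' = germ_L0 + fpsX * X' * (\sum_k fpsC (germ_b k) * Q' k) ->
    (Q' i = germ_L i + fpsX * X' * (\sum_k fpsC (germ_B i k) * Q' k) <-> E i = 0).
  move=> XE; have <- : Q' i - (germ_L i + fpsX * X' * (\sum_k fpsC (germ_B i k) * Q' k))
    = E i.
    rewrite BE /E /germ_L.
    transitivity (Q' i - fpsC (lam i * q0 i ^+ 2) * (germ_L0 + fpsX * X' * (\sum_k fpsC
      (germ_b k) * Q' k))
      - fpsC (lam i * q0 i) * (fpsX * Q' i * X')); first by ring.
    by rewrite -XE.
  by split=> [<-|/eqP]; rewrite ?subrr // subr_eq0 => /eqP.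
split.
- move=> [UE QE].
  have E0 j : E j = 0.
    by apply: fpsX_inj; rewrite /= -F1 QE subrr !mulr0.
  have G0 : G = 0.
    have avgE0 : fps_avg E = 0 by rewrite /fps_avg big1 ?mulr0.
    by apply: fpsX_inj; rewrite /= mulr0 -[G]addr0 -[0 in X in X =
      _](mulr0 (fpsC c * fpsC x0)) -avgE0 -F2 UE subrr.
  have XE := sysG.2 G0.
  by split=> // i; apply/(sysE i XE).
- move=> [XE QE]; have G0 := sysG.1 XE; have E0 j : E j = 0 by apply/(sysE j XE).
  have avgE0 : fps_avg E = 0 by rewrite /fps_avg big1 ?mulr0.
  split=> [|j]; apply/eqP; rewrite -subr_eq0; apply/eqP.
    by rewrite F2 G0 avgE0 mulr0 addr0 mulr0.
  have q1 : fpsC (1 - lam j * x0) * fpsC (q0 j) = 1.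
    by rewrite -rmorphM mulrC qE rmorph1.
  set Z := (X in X = 0); have qZ : fpsC (q0 j) * Z = 0 by rewrite F1 E0 mulr0.
  by rewrite -[Z]mul1r -q1 -mulrA qZ mulr0.
Qed.

End Germs.

Section GeometricSeries.
Variable R : realType.

Definition geom (q : R) : fps R := fun k => q ^+ k.

Lemma geomE q : geom q * (1 - fpsC q * fpsX) = 1.
Proof.
rewrite mulrBr mulr1 mulrCA [geom q * _]mulrC; apply/funext => k.
rewrite fpsBE fpsCM fpsXM fps1E /geom.
by case: k => [|k]; rewrite ?mulr0 ?subr0 // exprS subrr.
Qed.

Lemma ell1_geom q r : `|q| * r <= 2^-1 -> 0 <= r -> ell1 r (geom q).
Proof.
move=> qr r0; exists 2 => m.
(* The terms are at most 2^-k, so the partial sums are bounded by the closed form of that series. *)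
suff : psum (fps_abs (geom q)) r m <= 2 - 2 * 2^-1 ^+ m.
  by move=> /le_trans; apply; rewrite gerBl mulr_ge0.
elim: m => [|m IH]; first by rewrite /psum big_ord0 expr0 mulr1 subrr.
rewrite psumS fps_absE normrX -exprMn.
have : (`|q| * r) ^+ m <= 2^-1 ^+ m by rewrite lerXn2r // nnegrE // mulr_ge0.
by move: IH; rewrite exprS; lra.
Qed.

End GeometricSeries.

(** * The equation of theta *)

Section ThetaEquation.
Variables (R : realType) (n : nat) (lam : 'I_n -> R) (c : R).
Hypotheses (lam_ge0 : forall j, 0 <= lam j) (c_ge0 : 0 <= c).
Variable mu : {measure set R -> \bar R}.
Hypothesis stieltjesE : forall t, stieltjes mu t = avg (fun j => (lam j - t)^-1).
Variables (b : R) (theta : R -> R).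
Hypotheses (b_le0 : b <= 0) (htheta : G2_theta c mu b theta).

Lemma stieltjes_root x q : x < 0 -> (forall j, q j * (1 - lam j * x) = 1) ->
  stieltjes mu x^-1 = - (x * avg q).
Proof.
move=> x0 qE; rewrite stieltjesE /avg mulrCA -mulrN [x * _]mulr_sumr -sumrN; congr (_ * _).
apply: eq_bigr => j _.
have den : 1 - lam j * x != 0.
  by rewrite gt_eqF // subr_gt0 (le_lt_trans _ ltr01) // mulr_ge0_le0 // ltW.
have -> : q j = (1 - lam j * x)^-1 by apply: (mulIf den); rewrite qE mulVf.
have xn0 : x != 0 by rewrite lt_eqF.
have -> : lam j - x^-1 = - ((1 - lam j * x) / x) by field.
by rewrite invrN invf_div.
Qed.

Lemma G2_equation_root w x q : x < 0 -> (forall j, q j * (1 - lam j * x) = 1) ->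
  G2_equation c mu w x^-1 <-> x * (1 + c * (avg q - 1)) = w^-1.
Proof.
move=> x0 qE; rewrite /G2_equation (stieltjes_root x0 qE).
have xn0 : x != 0 by rewrite lt_eqF.
have -> : x^-1 * c * - (x * avg q) - (1 - c) + x^-1 / w =
    x^-1 * (w^-1 - x * (1 + c * (avg q - 1))).
  by generalize (w^-1) => s; field.
split=> [/eqP|->]; last by rewrite subrr mulr0.
by rewrite mulf_eq0 invr_eq0 (negPf xn0) subr_eq0 => /eqP.
Qed.

(** By uniqueness of the negative solution, any root x < 0, however obtained, is 1 / theta(w). *)
Lemma G2_root w x q : w < b -> x < 0 -> (forall j, q j * (1 - lam j * x) = 1) ->
  x * (1 + c * (avg q - 1)) = w^-1 -> G2 mu theta w = - (w^-1 * avg q).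
Proof.
move=> wb x0 qE xE; have [_ _ theta_unique] := htheta wb.
have xn0 : x != 0 by rewrite lt_eqF.
rewrite /G2; have <- : x^-1 = theta w.
  by apply: theta_unique; [rewrite invr_lt0 | apply/(G2_equation_root _ x0 qE)].
by rewrite (stieltjes_root x0 qE) mulrN mulrACA mulVf // mul1r.
Qed.

Lemma theta_root w : w < b -> exists x q,
  [/\ x < 0, forall j, q j * (1 - lam j * x) = 1 & x * (1 + c * (avg q - 1)) = w^-1].
Proof.
move=> wb; have [t0 tE _] := htheta wb.
have x0 : (theta w)^-1 < 0 by rewrite invr_lt0.
have qE j : (1 - lam j * (theta w)^-1)^-1 * (1 - lam j * (theta w)^-1) = 1.
  rewrite mulVf // gt_eqF // subr_gt0 (le_lt_trans _ ltr01) //.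
  by rewrite mulr_ge0_le0 // ltW.
exists (theta w)^-1, (fun j => (1 - lam j * (theta w)^-1)^-1); split=> //.
by apply/(G2_equation_root _ x0 qE); rewrite invrK.
Qed.

(* U(x) = x (1 + c (avg q - 1)) is convex on x < 0, so a critical point would be
   a minimum, whereas U takes the value 1 / w < 1 / w0 for w in ]w0, b[. *)
Lemma germ_det_neq0 w0 x0 q0 : w0 < b -> x0 < 0 ->
  (forall j, q0 j * (1 - lam j * x0) = 1) -> x0 * (1 + c * (avg q0 - 1)) = w0^-1 ->
  germ_det lam c x0 q0 != 0.
Proof.
move=> w0b x00 q0E x0E; apply/eqP => d0.
pose w := (w0 + b) / 2.
have [w0w wb] : w0 < w /\ w < b by rewrite /w; lra.
have [x [q [xn0 qE xE]]] := theta_root wb.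
have q_ge0 (y : R) p : y < 0 -> (forall j, p j * (1 - lam j * y) = 1) -> forall j, 0 <= p j.
  move=> y0 pE j; have den : 0 < 1 - lam j * y.
    by rewrite subr_gt0 (le_lt_trans _ ltr01) // mulr_ge0_le0 // ltW.
  by rewrite -(pmulr_lge0 _ den) pE.
(* The exact remainder of U at x0 to first order: it is nonnegative term by term, which is the
   convexity inequality without second derivatives. *)
have convex : x * (1 + c * (avg q - 1)) - x0 * (1 + c * (avg q0 - 1)) - germ_det lam c x0
  q0 * (x - x0)
    = c * avg (fun j => lam j * (x - x0) ^+ 2 * q j * q0 j ^+ 2).
  transitivity (c * (x * avg q - x0 * avg q0 - avg q0 * (x - x0) - x0 * (x - x0) * avg
    (fun j => lam j * q0 j ^+ 2))).
    by rewrite /germ_det; ring.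
  congr (_ * _); rewrite /avg ![_ * (n%:R^-1 * _)]mulrCA [_ * _ * (x - x0)]mulrAC -[_ *
    (x - x0) * _]mulrA.
  rewrite [(x - x0) * _]mulrC -!mulrBr; congr (_ * _).
  rewrite !mulr_sumr mulr_suml -!sumrB; apply: eq_bigr => j _.
  have q1 : q j - q0 j = lam j * (x - x0) * q j * q0 j.
    transitivity (q j * (q0 j * (1 - lam j * x0)) - q0 j * (q j * (1 - lam j * x))).
      by rewrite q0E qE !mulr1.
    by ring.
  have q2 : q j = q0 j + lam j * (x - x0) * q j * q0 j by rewrite -q1 addrC subrK.
  have q3 : x * q j - x0 * q0 j = (x - x0) * q j * q0 j.
    have -> : x * q j - x0 * q0 j = x * (q j * (q0 j * (1 - lam j * x0))) - x0 * (q0 j *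
      (q j * (1 - lam j * x))).
      by rewrite q0E qE !mulr1.
    by ring.
  transitivity (x * (q j - q0 j) - x0 * (x - x0) * (lam j * q0 j ^+ 2)); first by ring.
  rewrite q1; transitivity (lam j * (x - x0) * q0 j * (x * q j - x0 * q0 j)); first by ring.
  by rewrite q3; ring.
have : 0 <= w^-1 - w0^-1.
  rewrite -xE -x0E; move: convex; rewrite d0 mul0r subr0 => ->.
  rewrite mulr_ge0 // mulr_ge0 ?invr_ge0 ?ler0n // sumr_ge0 // => j _.
  have qj := q_ge0 x q xn0 qE j.
  by apply: mulr_ge0 (sqr_ge0 _); apply: mulr_ge0 qj; apply: mulr_ge0 (sqr_ge0 _).
have w_lt0 : w < 0 by exact: lt_le_trans b_le0.
have w0_lt0 : w0 < 0 by exact: lt_trans w_lt0.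
by rewrite subr_ge0 lef_nV2 ?negrE // leNgt w0w.
Qed.

Lemma ell1_avg r Q : 0 <= r -> (forall j, ell1 r (Q j)) -> ell1 r (@fps_avg R n Q).
Proof. by move=> r0 hQ; apply: ell1M => //; [exact: ell1C | exact: ell1_sum]. Qed.

Lemma ev_avg r Q e : `|e| <= r -> (forall j, ell1 r (Q j)) ->
  ev (@fps_avg R n Q) e = avg (fun j => ev (Q j) e).
Proof.
move=> er hQ; have r0 : 0 <= r by exact: le_trans er.
have hS : ell1 r (\sum_j Q j) by exact: ell1_sum.
by rewrite (evM er (@ell1C R r _) hS) evC (ev_sum _ _ er hQ).
Qed.

(** Evaluating the formal equations at a point of absolute convergence produces a numerical root,
    negative by assumption, to which [G2_root] applies. *)
Lemma G2_germ r X Q U e w : `|e| <= r -> ell1 r X -> (forall j, ell1 r (Q j)) ->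
  germ_eqs lam c X Q U -> ev X e < 0 -> ev U e = w^-1 -> w < b ->
  G2 mu theta w = - (w^-1 * ev (fps_avg Q) e).
Proof.
move=> er hX hQ [UE QE] X0 Uw wb; have r0 : 0 <= r by exact: le_trans er.
have hA := ell1_avg r0 hQ.
have hC a := @ell1C R r a; have h1 := @ell1_1 R r.
rewrite (ev_avg er hQ); apply: (G2_root wb X0) => [j|].
  have := congr1 (fun f => ev f e) (QE j).
  have hlX : ell1 r (fpsC (lam j) * X) by exact: ell1M.
  rewrite /= (evM er) //; last exact: ell1B.
  by rewrite (evB er) // ev1 (evM er) // evC.
rewrite -Uw -UE -(ev_avg er hQ).
have hA1 : ell1 r (fps_avg Q - 1) by exact: ell1B.
have hcA : ell1 r (fpsC c * (fps_avg Q - 1)) by exact: ell1M.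
rewrite (evM er) //; last exact: ell1D.
by rewrite (evD er) // ev1 (evM er) // evC (evB er) // ev1.
Qed.

End ThetaEquation.

(** * Analyticity of [G2] below b and its expansion near -oo *)

Section AnalyticContinuation.
Variables (R : realType) (n : nat) (lam : 'I_n -> R) (c : R).
Hypotheses (lam_ge0 : forall j, 0 <= lam j) (c_ge0 : 0 <= c).
Variable mu : {measure set R -> \bar R}.
Hypothesis stieltjesE : forall t, stieltjes mu t = avg (fun j => (lam j - t)^-1).
Variables (b : R) (theta : R -> R).
Hypotheses (b_le0 : b <= 0) (htheta : G2_theta c mu b theta).

(** The germ equations are solved with 1 / (w0 + e) as right-hand side; then G2(w0 + e) = - U(e) avg
    Q(e) is a convergent series in e. *)
Lemma G2_analytic w0 : w0 < b -> real_analytic_at (G2 mu theta) w0.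
Proof.
move=> w0b; have w0_lt0 : w0 < 0 by exact: lt_le_trans b_le0.
have w0n0 : w0 != 0 by rewrite lt_eqF.
have [x0 [q0 [x0_lt0 q0E x0E]]] := theta_root lam_ge0 stieltjesE htheta w0b.
have d0 := germ_det_neq0 lam_ge0 c_ge0 stieltjesE b_le0 htheta w0b x0_lt0 q0E x0E.
(* [U] is the expansion of 1 / (w0 + e) in e and [u'] is (U - 1 / w0) / e. The radius [r0] is half
   the distance from w0 to the pole 0, as [ell1_geom] requires. *)
pose U : fps R := fpsC w0^-1 * geom (- w0^-1).
pose u' : fps R := - (fpsC w0^-1 * U).
pose r0 := - w0 / 2.
have r0_gt0 : 0 < r0 by rewrite divr_gt0 // oppr_gt0.
have hU : ell1 r0 U.
  apply: ell1M; [exact: ltW | exact: ell1C |].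
  apply: ell1_geom; last exact: ltW.
  by rewrite normrN normfV ltr0_norm // /r0 mulrA mulVf ?oppr_eq0 // mul1r.
have hu' : ell1 r0 u' by apply: ell1N; apply: ell1M => //; [exact: ltW | exact: ell1C].
have w0C : fpsC w0^-1 * fpsC w0 = 1 by rewrite -rmorphM mulVf // rmorph1.
have UE1 : U * (fpsC w0 + fpsX) = 1.
  rewrite -(geomE (- w0^-1)) rmorphN /U.
  transitivity (geom (- w0^-1) * (fpsC w0^-1 * fpsC w0 + fpsC w0^-1 * fpsX)); first by ring.
  by rewrite w0C; ring.
have UE2 : U = fpsC w0^-1 + fpsX * u'.
  rewrite /u'; transitivity (U * (fpsC w0^-1 * (fpsC w0 + fpsX)) - fpsX * (fpsC w0^-1 * U)).
    by rewrite mulrDr w0C; ring.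
  by rewrite mulrCA UE1; ring.
have [X' [Q' sys]] := quadratic_system_exists (germ_L0 lam c x0 q0 u')
  (germ_L lam c x0 q0 u') (germ_b lam c x0 q0) (germ_B lam c x0 q0).
have [r1 [r1_gt0 hX' hQ']] : exists r', [/\ 0 < r', ell1 r' X' & forall i, ell1 r' (Q' i)].
  have hL0 : ell1 r0 (germ_L0 lam c x0 q0 u').
    by apply: ell1M => //; [exact: ltW | exact: ell1C].
  apply: (quadratic_system_ell1 r0_gt0 hL0 _ sys) => i.
  exact: (ell1M (ltW r0_gt0) (ell1C _ _) hL0).
have eqs := (germ_eqs_quadratic u' x0E q0E d0 X' Q').2 sys.
rewrite -UE2 in eqs.
pose r2 := Num.min r0 r1.
have r2_gt0 : 0 < r2 by rewrite lt_min r0_gt0.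
have r2_ge0 := ltW r2_gt0.
have lift0 f : ell1 r0 f -> ell1 r2 f by apply: ell1_leX; rewrite // /r2 ge_min lexx.
have lift1 f : ell1 r1 f -> ell1 r2 f by apply: ell1_leX; rewrite // /r2 ge_min lexx orbT.
set X := fpsC x0 + _ in eqs; set Q := fun j => _ in eqs.
have hX : ell1 r2 X.
  by apply: ell1D => //; [exact: ell1C | apply: ell1M => //; [exact: ell1X | exact: lift1]].
have hQ j : ell1 r2 (Q j).
  by apply: ell1D => //; [exact: ell1C | apply: ell1M => //; [exact: ell1X | exact: lift1]].
have hA := ell1_avg r2_ge0 hQ.
have [K K0 X'K] := ev_bounded r2_ge0 (lift1 _ hX').
(* The bound - x0 / (K + 1) keeps the root x0 + e X'(e) negative, and b - w0 keeps the point below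
   b, where [theta] is a solution. *)
pose r := Num.min r2 (Num.min (- x0 / (K + 1)) (b - w0)).
have K1 : 0 < K + 1 by rewrite ltr_wpDl.
have r_gt0 : 0 < r.
  by rewrite lt_min r2_gt0 lt_min divr_gt0 ?oppr_gt0 // subr_gt0.
exists (- (U * fps_avg Q)), r; split=> // y.
rewrite lt_min => /andP[yr2]; rewrite lt_min => /andP[yx0 yb]; pose e := y - w0.
have er : `|e| <= r2 by exact: ltW.
rewrite series_psum -/e.
have yltb : y < b by have := le_lt_trans (ler_norm _) yb; rewrite ltrD2r.
have -> : G2 mu theta y = ev (- (U * fps_avg Q)) e.
  have evU : ev U e = y^-1.
    have hw : ell1 r2 (fpsC w0 + fpsX) by apply: ell1D => //; [exact: ell1C | exact: ell1X].
    have := congr1 (fun f => ev f e) UE1; rewrite /= (evM er (lift0 _ hU) hw) ev1.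
    rewrite (evD er (@ell1C R r2 _) (ell1X r2_ge0)) evC evX (_ : w0 + e = y);
      last by rewrite /e addrC subrK.
    move=> Uy.
    have yn0 : y != 0 by rewrite lt_eqF // (lt_le_trans yltb).
    by apply: (mulIf yn0); rewrite Uy mulVf.
  rewrite (evN er); last by apply: ell1M => //; exact: lift0.
  rewrite (evM er (lift0 _ hU) hA) evU.
  apply: (G2_germ lam_ge0 stieltjesE htheta er hX hQ eqs) => //.
  have hzX : ell1 r2 (fpsX * X') by apply: ell1M => //; [exact: ell1X | exact: lift1].
  rewrite (evD er (@ell1C R r2 _) hzX) evC (evM er (ell1X r2_ge0) (lift1 _ hX')) evX.
  have : e * ev X' e <= `|e| * K.
    by apply: le_trans (ler_norm _) _; rewrite normrM ler_wpM2l // X'K.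
  have : `|e| * (K + 1) < - x0 by rewrite -ltr_pdivlMr.
  have := normr_ge0 e; rewrite mulrDr mulr1; lra.
by apply: (ev_cvg er); apply: ell1N; apply: ell1M => //; exact: lift0.
Qed.

(** The base point is x = 0, u = 0, that is w = -oo, where all q_j and the determinant equal 1. The
    formal solution is known there, so the quadratic system serves to prove that it converges. *)
Lemma G2_series (nu m : fps R) : (0 < n)%N -> nu 0%N = 1 ->
  (forall k, m k = avg (fun j => lam j ^+ k)) ->
  (forall X : fps R, X * (1 + fpsC c * (nu - 1)) = fpsX -> fps_comp m X = nu) ->
  exists r, forall w, w < r ->
    series (fun k => - (nu k / w ^+ k.+1)) @ \oo --> G2 mu theta w.
Proof.
move=> n_gt0 nu0 mE mcomp.
have n0 : n%:R != 0 :> R by rewrite pnatr_eq0 -lt0n.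
pose y := - (fpsC c * (nu - 1)).
have y0 : y 0%N = 0 by rewrite /y fpsNE fpsCM fpsBE fps1E nu0 subrr mulr0 oppr0.
pose W := star y; pose X := fpsX * W.
have WE : W * (1 + fpsC c * (nu - 1)) = 1 by rewrite -[fpsC c * _]opprK; exact: starMr.
have XE : X * (1 + fpsC c * (nu - 1)) = fpsX by rewrite -mulrA WE mulr1.
have X0 : X 0%N = 0 by rewrite /X fpsXM.
(* This is 1 / (1 - lam_j X); its average over j is the moment series m composed with X, which is
   [nu]. *)
pose Q j := fps_comp (geom (lam j)) X.
have avgQ : fps_avg Q = nu.
  rewrite -(mcomp X XE); apply/funext => k; rewrite /fps_avg fpsCM fps_sumE fps_compE.
  under eq_bigr do rewrite /Q fps_compE.
  rewrite exchange_big mulr_sumr; apply: eq_bigr => i _.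
  by rewrite mE /avg -mulr_suml mulrA.
have QE j : Q j * (1 - fpsC (lam j) * X) = 1.
  transitivity (fps_comp (geom (lam j) * (1 - fpsC (lam j) * fpsX)) X).
    by rewrite fps_compM // fps_compD fps_comp1 fps_compN fps_compM // fps_compC fps_compX.
  by rewrite geomE fps_comp1.
have eqs : germ_eqs lam c X Q fpsX by split; rewrite ?avgQ.
pose Q' j : fps R := fun k => Q j k.+1.
have Q0 j : Q j = fpsC 1 + fpsX * Q' j.
  apply/funext => -[|k]; rewrite fpsDE fpsXM ?add0r // addr0.
  by rewrite /Q fps_compE big_ord1 /geom !expr0 fps1E mulr1.
have avg1 : avg (fun _ : 'I_n => 1 : R) = 1.
  by rewrite /avg sumr_const card_ord mulVf.
have d1 : germ_det lam c 0 (fun=> 1) = 1.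
  by rewrite /germ_det avg1 subrr !mulr0 mul0r !addr0.
have sys : quadratic_system (germ_L0 lam c 0 (fun=> 1) 1) (germ_L lam c 0 (fun=> 1) 1)
    (germ_b lam c 0 (fun=> 1)) (germ_B lam c 0 (fun=> 1)) W Q'.
  apply/(germ_eqs_quadratic (u0 := 0)).
  - by rewrite mul0r.
  - by move=> j; rewrite mulr0 subr0 mulr1.
  - by rewrite d1 oner_neq0.
  rewrite !rmorph0 !add0r mulr1 -/X.
  by have <- : Q = (fun j => fpsC 1 + fpsX * Q' j) by apply/funext.
have [r1 [r1_gt0 hW hQ']] : exists r', [/\ 0 < r', ell1 r' W & forall i, ell1 r' (Q' i)].
  have hL0 : ell1 1 (germ_L0 lam c 0 (fun=> 1) 1).
    by apply: ell1M => //; [exact: ell1C | exact: ell1_1].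
  apply: (quadratic_system_ell1 ltr01 hL0 _ sys) => i.
  exact: (ell1M ler01 (ell1C _ _) hL0).
have r1_ge0 := ltW r1_gt0.
have hz := ell1X r1_ge0.
have hX : ell1 r1 X by exact: ell1M.
have hQ j : ell1 r1 (Q j).
  by rewrite Q0; apply: ell1D => //; [exact: ell1C | exact: ell1M].
have hnu : ell1 r1 nu by rewrite -avgQ; exact: ell1_avg.
pose p' := fps_avg Q'.
have hp' : ell1 r1 p' by exact: ell1_avg.
have nuE : nu = 1 + fpsX * p'.
  rewrite -avgQ (_ : Q = fun j => fpsC 1 + fpsX * Q' j); last exact/funext.
  by rewrite fps_avgD fps_avgC avg1 rmorph1 fps_avgZ.
have [K K0 p'K] := ev_bounded r1_ge0 hp'.
have cK : 0 < c * K + 1 by rewrite ltr_wpDl // mulr_ge0.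
(* For |e| below this radius, |c e p'(e)| < 1, hence W(e) = 1 / (1 + c e p'(e)) is positive and X(e)
   = e W(e) has the negative sign of e = 1 / w. *)
pose r := Num.min r1 (c * K + 1)^-1.
have r_gt0 : 0 < r by rewrite lt_min r1_gt0 invr_gt0.
exists (Num.min b (- r^-1)) => w; rewrite lt_min => /andP[wb wr].
have w_lt0 : w < 0 by exact: lt_le_trans b_le0.
have wn0 : w != 0 by rewrite lt_eqF.
pose e := w^-1.
have e_lt0 : e < 0 by rewrite invr_lt0.
have er' : `|e| < r.
  by rewrite ltr0_norm // /e -invrN invf_plt ?posrE ?oppr_gt0 // ltrNr.
have er : `|e| <= r1 by move: er'; rewrite lt_min => /andP[/ltW].
have hcz : ell1 r1 (fpsC c * (fpsX * p')) by apply: ell1M => //;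
  [exact: ell1C | exact: ell1M].
have Wgt0 : 0 < ev W e.
  have den : 0 < 1 + c * (e * ev p' e).
    have h1 : `|c * (e * ev p' e)| <= `|e| * (c * K).
      rewrite !normrM (ger0_norm c_ge0) mulrCA ler_wpM2l // ler_wpM2l //.
      exact: p'K.
    have h2 : `|e| * (c * K + 1) < 1.
      by rewrite -ltr_pdivlMr // mul1r; move: er'; rewrite lt_min => /andP[].
    have := normr_ge0 e; have := lerNnormlW h1; move: h2; rewrite mulrDr mulr1; lra.
  have := congr1 (fun f => ev f e) WE; rewrite nuE addrAC subrr add0r /=.
  have h1z : ell1 r1 (1 + fpsC c * (fpsX * p')) by apply: ell1D => //; exact: ell1_1.
  rewrite (evM er hW h1z) (evD er (@ell1_1 R r1) hcz) ev1.
  rewrite (evM er (@ell1C R r1 c) (ell1M r1_ge0 hz hp')) evC (evM er hz hp') evX => We.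
  by rewrite -(pmulr_lgt0 _ den) We.
have -> : G2 mu theta w = - (w^-1 * ev nu e).
  rewrite -avgQ; apply: (G2_germ lam_ge0 stieltjesE htheta er hX hQ eqs) => //.
    by rewrite (evM er hz hW) evX nmulr_rlt0.
  by rewrite evX.
have -> : series (fun k => - (nu k / w ^+ k.+1)) = (fun N => - (w^-1 * psum nu e N)).
  apply/funext => N; rewrite /series /= big_mkord sumrN mulr_sumr; congr (- _).
  apply: eq_bigr => k _; rewrite /e exprS invfM exprVn; ring.
by apply: cvgN; apply: cvgMr; exact: ev_cvg er hnu.
Qed.

End AnalyticContinuation.

(** * Uniqueness of the analytic continuation *)

Section IdentityTheorem.
Variable R : realType.
Implicit Types (f g : R -> R) (a d : fps R).

(** Abel's argument: the terms at e are bounded by some M, so at half the radius they are at most M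
    2^-k. *)
Lemma cvg_psum_ell1 a (e l : R) : e != 0 -> psum a e @ \oo --> l -> ell1 (`|e| / 2) a.
Proof.
move=> e0 ae; have e_gt0 : 0 < `|e| by rewrite normr_gt0.
have : cvgn (series (fun k => a k * e ^+ k)) by rewrite series_psum; apply/cvg_ex; exists l.
move=> /cvg_series_bounded [M0 [_ Mb0]]; pose M := M0 + 1.
have Mb k : `|a k * e ^+ k| <= M by apply: (Mb0 M) => //; rewrite ltrDl.
exists (2 * M) => m.
suff : psum (fps_abs a) (`|e| / 2) m <= 2 * M - 2 * M * 2^-1 ^+ m.
  move=> /le_trans; apply; rewrite gerBl mulr_ge0 // mulr_ge0 //.
  by apply: le_trans (Mb 0%N).
elim: m => [|m IH]; first by rewrite /psum big_ord0 expr0 mulr1 subrr.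
rewrite psumS fps_absE exprMn.
have : `|a m| * (`|e| ^+ m * 2^-1 ^+ m) <= M * 2^-1 ^+ m.
  by rewrite mulrA ler_wpM2r ?exprn_ge0 // -normrX -normrM; exact: Mb.
by move: IH; rewrite exprS; lra.
Qed.

Definition fps_tail d : fps R := fun k => d k.+1.

Lemma fps_tailE d : d = fpsC (d 0%N) + fpsX * fps_tail d.
Proof. by apply/funext => -[|m]; rewrite fpsDE fpsXM ?addr0 // add0r. Qed.

Lemma ell1_tail (r : R) d : 0 < r -> ell1 r d -> ell1 r (fps_tail d).
Proof.
move=> r0 [K dK]; exists (K / r) => m; rewrite ler_pdivlMr // mulrC -psum_shift.
apply: le_trans (dK m.+1); apply: psum_le (ltW r0) => -[|j]; rewrite fpsXM //.
by rewrite fps_absE.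
Qed.

Lemma ev_tail (r e : R) d : 0 < r -> `|e| <= r -> ell1 r d ->
  ev d e = d 0%N + e * ev (fps_tail d) e.
Proof.
move=> r0 er hd; have hz := ell1X (ltW r0); have hd' := ell1_tail r0 hd.
by rewrite {1}(fps_tailE d) (evD er (@ell1C R r _) (ell1M (ltW r0) hz hd')) evC (evM er
  hz hd') evX.
Qed.

(** Since d(e) = d_0 + e t(e) with t bounded, vanishing for negative e gives |d_0| <= K |e| for e
    arbitrarily small. *)
Lemma ev_eq0_left0 d (r : R) : 0 < r -> ell1 r d ->
  (forall e, - r < e -> e < 0 -> ev d e = 0) -> d 0%N = 0.
Proof.
move=> r0 hd d0; have [K K0 d'K] := ev_bounded (ltW r0) (ell1_tail r0 hd).
apply/eqP/negPn/negP; rewrite -normr_gt0 => dn0.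
have K1 : 0 < 2 * (K + 1) by rewrite mulr_gt0 // ltr_wpDl.
(* Chosen so that e (K + 1) is at most half of |d_0|, contradicting |d_0| <= e K at the point -
   e. *)
pose e := Num.min (r / 2) (`|d 0%N| / (2 * (K + 1))).
have e_gt0 : 0 < e by rewrite lt_min !divr_gt0.
have er : e < r by rewrite gt_min; apply/orP; left; lra.
have ed : e * (2 * (K + 1)) <= `|d 0%N| by rewrite -ler_pdivlMr // ge_min lexx orbT.
have ner : `|- e| <= r by rewrite normrN gtr0_norm // ltW.
have := ev_tail r0 ner hd; rewrite d0 ?ltrN2 ?oppr_lt0 // mulNr.
move=> /eqP; rewrite eq_sym subr_eq0 => /eqP d0E.
have : `|d 0%N| <= e * K.
  by rewrite d0E normrM (gtr0_norm e_gt0) ler_wpM2l ?d'K // ltW.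
nra.
Qed.

(** Once d_0 = 0, dividing by e <> 0 shows that the tail vanishes on the same interval, and the
    coefficients are peeled off one at a time. *)
Lemma ev_eq0_left d (r : R) : 0 < r -> ell1 r d ->
  (forall e, - r < e -> e < 0 -> ev d e = 0) -> forall k, d k = 0.
Proof.
move=> r0 + + k; elim: k d => [|k IH] d hd d0; first exact: ev_eq0_left0 r0 hd d0.
apply: (IH (fps_tail d)); first exact: ell1_tail.
move=> e re e0; have er : `|e| <= r by rewrite ltr0_norm // lerNl ltW.
have := ev_tail r0 er hd; rewrite d0 // (ev_eq0_left0 r0 hd d0) add0r => /esym/eqP.
by rewrite mulf_eq0 (lt_eqF e0) => /eqP.
Qed.

(** The difference of the two expansions at s vanishes to the left of s, so all its coefficients are
    0 and the agreement crosses to the right. *)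
Lemma real_analytic_local f g s : real_analytic_at f s -> real_analytic_at g s ->
  (forall w, w < s -> f w = g w) ->
  exists2 r, 0 < r & forall w, `|w - s| < r -> f w = g w.
Proof.
move=> [a [r1 [r10 aE]]] [a' [r2 [r20 a'E]]] fg.
pose r := Num.min r1 r2; have r0 : 0 < r by rewrite lt_min r10.
exists r => // w ws; pose d : fps R := (a : fps R) - a'.
have dE y : `|y - s| < r -> psum d (y - s) @ \oo --> f y - g y.
  rewrite lt_min => /andP[/aE + /a'E]; rewrite !series_psum => ha ha'.
  rewrite (_ : psum d (y - s) = psum a (y - s) \- psum a' (y - s)); first exact: cvgB.
  by apply/funext => m; rewrite /d psumD psumN.
pose e0 := r / 2.
have e0_gt0 : 0 < e0 by rewrite divr_gt0.
have hd : ell1 (e0 / 2) d.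
  have -> : e0 = `|(s + e0) - s| by rewrite addrAC subrr add0r gtr0_norm.
  apply: (@cvg_psum_ell1 _ _ (f (s + e0) - g (s + e0))).
    by rewrite addrAC subrr add0r gt_eqF.
  by apply: dE; rewrite addrAC subrr add0r gtr0_norm // /e0; lra.
have d0 : forall k, d k = 0.
  apply: (ev_eq0_left _ hd); first by rewrite divr_gt0.
  move=> e he e_lt0; apply: ev_unique.
  have := dE (s + e); rewrite addrAC subrr add0r fg ?gtrDl // subrr; apply.
  by rewrite ltr0_norm //; move: he; rewrite /e0; lra.
have := dE w ws; rewrite (_ : psum d (w - s) = cst 0); last first.
  by apply/funext => m; rewrite /psum big1 // => k _; rewrite d0 mul0r.
move=> /(cvg_unique (@norm_hausdorff _ _)) /(_ (cvg_cst _)) /eqP.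
by rewrite subr_eq0 => /eqP.
Qed.

(** Connectedness of the half-line: take the supremum of the x <= z with f = g on ]-oo, x]. Below z,
    [real_analytic_local] would push it further. *)
Lemma real_analytic_unique f g (z r : R) :
  (forall w, w <= z -> real_analytic_at f w) -> (forall w, w <=
    z -> real_analytic_at g w) ->
  (forall w, w < r -> f w = g w) -> f z = g z.
Proof.
move=> fa ga fg; pose S : set R := [set x | x <= z /\ forall w, w <= x -> f w = g w].
have S0 : S (Num.min z (r - 1)).
  split=> [|w]; first by rewrite ge_min lexx.
  by rewrite le_min => /andP[_ wr]; apply: fg; lra.
have Ssup : has_sup S by split; [exists (Num.min z (r - 1)) | exists z => x []].
have sz : sup S <= z by apply: ge_sup; [exists (Num.min z (r - 1)) | move=> x []].
have below w : w < sup S -> f w = g w.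
  move=> ws; have eps0 : 0 < sup S - w by rewrite subr_gt0.
  have [x [_ Sx]] := sup_adherent eps0 Ssup.
  by rewrite opprB addrC subrK => /ltW /Sx.
have [rho rho0 near_s] := real_analytic_local (fa _ sz) (ga _ sz) below.
have [sltz|zs] := ltP (sup S) z; last first.
  apply: near_s; have -> : z = sup S by apply/le_anti; rewrite zs sz.
  by rewrite subrr normr0.
have : S (Num.min z (sup S + rho / 2)).
  split=> [|w]; first by rewrite ge_min lexx.
  rewrite le_min => /andP[_ wr]; have [/below //|sw] := ltP w (sup S).
  by apply: near_s; rewrite ger0_norm ?subr_ge0 //; lra.
move=> /(ub_le_sup (proj2 Ssup)); rewrite ge_min.
by move=> /orP[|]; [rewrite leNgt sltz | lra].
Qed.

End IdentityTheorem.

(** Two continuations are near -oo the sum of the same series, hence agree at z; the choice made by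
    [xget] is therefore forced. *)
Lemma moment_stieltjes_unique (R : realType) (m : nat -> R) (z v : R) :
  is_moment_stieltjes m z v -> moment_stieltjes m z = v.
Proof.
move=> mv; apply: xget_subset1 => // v1 v2.
move=> [f [fa [r1 fr] <-]] [g [ga [r2 gr] <-]].
apply: (real_analytic_unique (r := Num.min r1 r2)) => // w.
rewrite lt_min => /andP[/fr fw /gr gw].
by rewrite -(cvg_lim (@norm_hausdorff _ _) fw) (cvg_lim (@norm_hausdorff _ _) gw).
Qed.

Unset Implicit Arguments.

Theorem theorem5p1 (R : realType) (d : measure_display) (T : measurableType d)
    (P : probability T R)
    (c : R) (N : nat -> nat)
    (hN : forall n, (0 < N n)%N)
    (hc : (fun n : nat => n%:R / (N n)%:R : R) @ \oo --> c)
    (y : forall n, 'I_(N n) -> T -> 'cV[R[i]]_n)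
    (hy : forall n, iid_random_vectors P (y n))
    (mu_c : probability R R) (hmu_c : marchenko_pastur c mu_c)
    (n : nat) (hn : (0 < n)%N) (omega : T)
    (mu_Gamma : {measure set R -> \bar R})
    (hmu_Gamma : mu_Gamma = empirical_eigenvalue_distribution
       (sample_covariance (fun i => y n i omega)))
    (b : R) (hb : b <= 0) (theta : R -> R)
    (htheta : G2_theta c mu_Gamma b theta)
    (nu : nat -> R)
    (hnu : free_muldeconv (moment mu_Gamma) (moment mu_c) nu)
    (z : R) (hz : z < b) :
  G2 mu_Gamma theta z = moment_stieltjes nu z.
Proof.
pose lam (j : 'I_n) := complex.Re (spectral_diag (sample_covariance (fun i =>
  y n i omega)) 0 j).
have lam_ge0 j : 0 <= lam j by exact: sample_covariance_spectrum_ge0.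
have mu_avg f : measurable_fun [set: R] f ->
    Rintegral mu_Gamma setT f = avg (fun j => f (lam j)).
  move=> mf; rewrite hmu_Gamma /empirical_eigenvalue_distribution Rintegral_atomic //.
  congr (_ * _); apply: eq_bigr => k _; congr f.
  by rewrite (nth_map k) ?size_enum_ord // nth_ord_enum.
have stieltjesE t : stieltjes mu_Gamma t = avg (fun j => (lam j - t)^-1).
  by rewrite /stieltjes mu_avg //; exact: measurable_subV.
have momentE k : moment mu_Gamma k = avg (fun j => lam j ^+ k).
  by rewrite /moment mu_avg //; exact: exprn_measurable.
(* The sign comes from c being a limit of the ratios n / N. *)
have c_ge0 : 0 <= c.
  rewrite -(cvg_lim _ hc) //; apply: limr_ge; first by apply/cvg_ex; exists c.
  by apply: nearW => k; rewrite divr_ge0.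
have [nu0 nu_comp] := free_mulconv_mp hnu (proj2 hmu_c).
apply/esym/moment_stieltjes_unique.
(* [G2] itself is the continuation: it is analytic at every w <= z because z < b. *)
exists (G2 mu_Gamma theta); split=> // [w wz|].
  apply: (G2_analytic lam_ge0 c_ge0 stieltjesE hb htheta).
  exact: le_lt_trans hz.
exact: (G2_series lam_ge0 c_ge0 stieltjesE hb htheta hn nu0 momentE nu_comp).
Qed.
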